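(* Suppose there is a $(2-\delta)$-approximation algorithm for Graphic Uncapacitated Multi-Depot VRP, for some constant $\delta>0$. Then there is also an approximation algorithm with approximation factor $2-f(\delta)$ for Graphic Multi-Path TSP, where $f$ is a strictly positive function.
   Context: Graphic Multi-Path TSP: the input is an undirected connected graph $G=(V,E)$ (unit edge costs) and a list of pairwise distinct source-sink pairs $(s_1,t_1),\ldots,(s_k,t_k)$ with $s_i,t_i\in V$. A feasible solution is a collection of walks $P_1,\ldots,P_k$ with $P_i$ an $s_i$-$t_i$ walk (a single vertex allowed if $s_i=t_i$), such that every vertex of $V$ lies on some $P_i$; its cost is $\sum_i|P_i|$, the number of edge traversals counted with multiplicity, to be minimized. Graphic Uncapacitated Multi-Depot VRP is the special case of Graphic Multi-Path TSP in which $s_i=t_i$ for all $i\in[k]$. An $\alpha$-approximation algorithm is a polynomial-time algorithm returning a feasible solution of cost at most $\alpha$ times the optimum. *)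

(* Defs.v *)
From mathcomp Require Import all_boot all_order all_algebra.
From mathcomp Require Import reals.

Set Implicit Arguments.
Unset Strict Implicit.
Unset Printing Implicit Defensive.

(* Model of computation: deterministic WHILE programs over binary trees (in the
   style of N. Jones, "Computability and Complexity from a Programming
   Perspective").  Every evaluation of an expression is charged the total size
   of the trees it reads or produces, as if they were copied node by node, so a
   run of cost T never reads or builds a tree of size more than T.  Hence these
   programs and multi-tape Turing machines simulate each other with polynomial
   overhead. *)

Inductive tree := Leaf | Node of tree & tree.

Fixpoint tree_size (t : tree) : nat :=
  if t is Node l r then (tree_size l + tree_size r).+1 else 1.

Fixpoint tree_eqb (t u : tree) : bool :=
  match t, u with
  | Leaf, Leaf => true
  | Node a b, Node c d => tree_eqb a c && tree_eqb b d
  | _, _ => false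
  end.

Definition tree_hd (t : tree) : tree := if t is Node l _ then l else Leaf.
Definition tree_tl (t : tree) : tree := if t is Node _ r then r else Leaf.

(* [Leaf] is false, every other tree is true. *)
Definition truthy (t : tree) : bool := if t is Node _ _ then true else false.
Definition enc_bool (b : bool) : tree := if b then Node Leaf Leaf else Leaf.

Inductive expr :=
  | EVar of nat
  | ELeaf
  | ENode of expr & expr
  | EHd of expr
  | ETl of expr
  | EEq of expr & expr.

Definition store := nat -> tree.

Definition update (s : store) (x : nat) (t : tree) : store :=
  fun y => if y == x then t else s y.

Fixpoint eval (s : store) (e : expr) : tree :=
  match e with
  | EVar x => s x
  | ELeaf => Leaf
  | ENode e1 e2 => Node (eval s e1) (eval s e2)
  | EHd e1 => tree_hd (eval s e1)
  | ETl e1 => tree_tl (eval s e1)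
  | EEq e1 e2 => enc_bool (tree_eqb (eval s e1) (eval s e2))
  end.

Fixpoint eval_cost (s : store) (e : expr) : nat :=
  tree_size (eval s e) +
  match e with
  | EVar _ | ELeaf => 0
  | EHd e1 | ETl e1 => eval_cost s e1
  | ENode e1 e2 | EEq e1 e2 => eval_cost s e1 + eval_cost s e2
  end.

Inductive cmd :=
  | CSkip
  | CAssign of nat & expr
  | CSeq of cmd & cmd
  | CIf of expr & cmd & cmd
  | CWhile of expr & cmd.

(* [exec c s T s']: started in [s], [c] halts in [s'] after time [T]. *)
Inductive exec : cmd -> store -> nat -> store -> Prop :=
  | ExecSkip s : exec CSkip s 1 s
  | ExecAssign s x e :
      exec (CAssign x e) s (eval_cost s e).+1 (update s x (eval s e))
  | ExecSeq c1 c2 s s1 s2 T1 T2 :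
      exec c1 s T1 s1 -> exec c2 s1 T2 s2 ->
      exec (CSeq c1 c2) s (T1 + T2).+1 s2
  | ExecIf e c1 c2 s s' T :
      exec (if truthy (eval s e) then c1 else c2) s T s' ->
      exec (CIf e c1 c2) s (eval_cost s e + T).+1 s'
  | ExecWhileF e c s :
      ~~ truthy (eval s e) ->
      exec (CWhile e c) s (eval_cost s e).+1 s
  | ExecWhileT e c s s1 s2 T1 T2 :
      truthy (eval s e) ->
      exec c s T1 s1 -> exec (CWhile e c) s1 T2 s2 ->
      exec (CWhile e c) s (eval_cost s e + T1 + T2).+1 s2.

(* Input and output are passed in variable 0; all others start as [Leaf]. *)
Definition init_store (t : tree) : store := update (fun=> Leaf) 0 t.

Definition computes_in (c : cmd) (input : tree) (T : nat) (output : tree) :=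
  exists2 s, exec c (init_store input) T s & s 0 = output.

(* Finite simple connected graphs; the vertex set is [0, n) so that vertices can
   be written down. *)
Record connected_graph := ConnectedGraph {
  order : nat;
  adj : rel 'I_order;
  adj_sym : symmetric adj;
  adj_irr : irreflexive adj;
  adj_connected : forall x y, connect adj x y
}.

(* There is at least one pair: with none, no solution could cover a vertex. *)
Record instance := Instance {
  graph : connected_graph;
  pairs : seq ('I_(order graph) * 'I_(order graph));
  pairs_uniq : uniq pairs;
  pairs_neq0 : 0 < size pairs
}.

Notation vertex I := 'I_(order (graph I)).

(* A walk is the nonempty list of the vertices it traverses. *)
Definition is_walk (G : connected_graph) (s t : 'I_(order G))
    (w : seq 'I_(order G)) : bool :=
  if w is x :: p then [&& x == s, path (@adj G) x p & last x p == t] else false.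

Definition walk_length (V : Type) (w : seq V) : nat := (size w).-1.

Definition feasible (I : instance) (P : seq (seq (vertex I))) : bool :=
  all2 (fun st w => is_walk st.1 st.2 w) (pairs I) P
  && [forall v : vertex I, has (fun w => v \in w) P].
Arguments feasible : clear implicits.

Definition cost (V : Type) (P : seq (seq V)) : nat :=
  \sum_(w <- P) walk_length w.

Definition optimal (I : instance) (P : seq (seq (vertex I))) : Prop :=
  feasible I P /\ forall Q : seq (seq (vertex I)), feasible I Q -> cost P <= cost Q.
Arguments optimal : clear implicits.

(* Numbers are in unary, which is polynomially equivalent here, as every number
   written down is smaller than the number of vertices. *)
Definition enc_nat (n : nat) : tree := iter n (Node Leaf) Leaf.

Definition enc_seq (T : Type) (enc : T -> tree) (s : seq T) : tree :=
  foldr (fun x t => Node (enc x) t) Leaf s.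

(* Adjacency matrix, then the list of source-sink pairs. *)
Definition enc_instance (I : instance) : tree :=
  Node
    (enc_seq (fun x => enc_seq (fun y => enc_bool (adj x y)) (enum (vertex I)))
       (enum (vertex I)))
    (enc_seq (fun st : vertex I * vertex I =>
       Node (enc_nat st.1) (enc_nat st.2)) (pairs I)).

Definition enc_solution (n : nat) (P : seq (seq 'I_n)) : tree :=
  enc_seq (enc_seq (fun v : 'I_n => enc_nat v)) P.

(* A problem is given by the instances it allows. *)
Definition graphic_multi_path_tsp (I : instance) : Prop := True.

Definition graphic_multi_depot_vrp (I : instance) : Prop :=
  forall st, st \in pairs I -> st.1 = st.2.

Definition approx_solution (R : realType) (alpha : R) (I : instance)
    (P : seq (seq (vertex I))) : Prop :=
  feasible I P /\
  forall Q : seq (seq (vertex I)), optimal I Q ->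
    ((cost P)%:R <= alpha * (cost Q)%:R)%R.
Arguments approx_solution {R} alpha I P.

Definition is_approx_algorithm (R : realType) (problem : instance -> Prop)
    (alpha : R) (c : cmd) : Prop :=
  exists a d : nat, forall I : instance, problem I ->
    exists T (P : seq (seq (vertex I))),
      [/\ computes_in c (enc_instance I) T (enc_solution P),
          T <= a * tree_size (enc_instance I) ^ d + a
        & approx_solution alpha I P].

(* Main.v *)
(* Let [D] be the sum of the distances from [s_i] to [t_i], so [D <= OPT].  The
   algorithm outputs the cheaper of two solutions.

   The first runs the given algorithm with the sources as depots and adds a
   shortest path to every pair.  Closing up the optimal walks by shortest paths
   gives tours of cost [OPT + D], so this costs at most
   [(2 - delta) (OPT + D) + D], which is good when [D] is small.

   The second starts from simple [s_i]-[t_i] paths [Q_i], of total length [q], and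
   visits each of the [u] vertices they miss by a detour of cost 2.  The paths come
   from a local search: a path pays 0, 3 or 4 at a vertex used by 0, 1 or at least 2
   of the other paths (always 4 at a source), and [Q_i] is replaced as long as some
   cheaper [s_i]-[t_i] path exists.  Comparing [Q_i] with the [i]-th optimal walk and
   summing over [i] shows [16 (q + 2 u) + q <= 32 OPT], and [D <= q], so this is good
   when [D] is large.  With prices 0, 1, 1 the same argument would only
   give a factor 2: a second visit has to be cheaper than a third one.

   The weighted average [(c1 + 48 c2) / 49] of the two costs is at most
   [(2 - delta / 49) OPT] if [delta <= 1].

   For the running time, functions on encoded data computed by polynomial-time
   programs are closed under composition, pairing, conditionals and those folds
   whose accumulator grows by a polynomial amount in each step. *)
Require Import Defs.
From mathcomp Require Import all_boot all_order all_algebra.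
From mathcomp Require Import reals boolp.
From mathcomp Require Import zify lra.

Set Implicit Arguments.
Unset Strict Implicit.
Unset Printing Implicit Defensive.

(** * Polynomial bounds *)

(** The local search is best response in a congestion game. Since a price depends only on how many
    other paths use the vertex, the Rosenthal potential (over all vertices, the sum of the prices of
    its successive visits) changes by exactly as much as the price of the replaced path. Prices are
    integers of polynomial size, which bounds the number of improvements. Local optimality compares
    prices, not lengths. Five times its sum over all pairs is therefore combined with an inequality
    at each single vertex between the numbers of sources, of own paths and of optimal walks there.
    It is tight where one optimal walk passes: an uncovered vertex is charged 32, and a vertex on
    exactly one own path 17 + 5 * 3 = 32. The first solution contains [D] with coefficient
    [3 - delta], the second saves [D / 16]; hence the weight 48 = 3 * 16 in the average. The given
    algorithm is specified only on encodings of depot instances, so polynomial time has to be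
    relative to a domain of inputs. The algorithm itself works on lists of numbers, so that programs
    and proofs speak of the same functions. *)

Definition poly_bounded (B : nat -> nat) := exists d, forall n, B n <= n.+2 ^ d.

Lemma poly_bounded_le B C :
  (forall n, B n <= C n) -> poly_bounded C -> poly_bounded B.
Proof. by move=> BC [d Cd]; exists d => n; apply: leq_trans (BC n) (Cd n). Qed.

Lemma poly_bounded_id : poly_bounded (fun n => n).
Proof. by exists 1 => n; rewrite expn1; lia. Qed.

Lemma poly_bounded_const c : poly_bounded (fun=> c).
Proof.
exists c => n; apply: leq_trans (ltnW (ltn_expl c (ltnSn 1))) _.
by case: c => // c; rewrite leq_exp2r.
Qed.

Lemma poly_bounded_exp d : poly_bounded (fun n => n.+2 ^ d).
Proof. by exists d. Qed.

Lemma poly_bounded_add B C :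
  poly_bounded B -> poly_bounded C -> poly_bounded (fun n => B n + C n).
Proof.
move=> [d Bd] [e Ce]; exists (maxn d e).+1 => n; rewrite expnS.
have Bm : B n <= n.+2 ^ maxn d e.
  by apply: leq_trans (Bd n) _; rewrite leq_exp2l // leq_maxl.
have Cm : C n <= n.+2 ^ maxn d e.
  by apply: leq_trans (Ce n) _; rewrite leq_exp2l // leq_maxr.
by apply: leq_trans (leq_add Bm Cm) _; rewrite addnn -mul2n leq_mul2r orbT.
Qed.

Lemma poly_bounded_mul B C :
  poly_bounded B -> poly_bounded C -> poly_bounded (fun n => B n * C n).
Proof.
by move=> [d Bd] [e Ce]; exists (d + e) => n; rewrite expnD leq_mul.
Qed.

Lemma poly_bounded_comp B C :
  poly_bounded B -> poly_bounded C -> poly_bounded (fun n => B (C n)).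
Proof.
move=> [d Bd] pC.
have [e Ce] : poly_bounded (fun n => C n + 2).
  exact: poly_bounded_add pC (poly_bounded_const 2).
exists (e * d) => n; apply: leq_trans (Bd _) _; rewrite expnM.
by case: d {Bd} => // d; rewrite leq_exp2r // -addn2.
Qed.

Lemma poly_bounded_succ B : poly_bounded B -> poly_bounded (fun n => (B n).+1).
Proof.
move=> pB; apply: (poly_bounded_le (C := fun n => B n + 1)).
  by move=> n; rewrite addn1.
exact: poly_bounded_add pB (poly_bounded_const 1).
Qed.

Lemma poly_bounded_expn B d :
  poly_bounded B -> poly_bounded (fun n => B n ^ d).
Proof.
move=> [e Be]; exists (e * d) => n; rewrite expnM.
by case: d => // d; rewrite leq_exp2r.
Qed.

Ltac poly_bound :=
  repeat first
    [ exact: poly_bounded_const | exact: poly_bounded_id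
    | assumption | apply: poly_bounded_succ
    | apply: poly_bounded_expn
    | apply: poly_bounded_add | apply: poly_bounded_mul ].

(** * Encoded data *)

#[local] Obligation Tactic := idtac.

(* Up to polynomials [nrm] is the size of the encoding, but it grows only by
   a constant when an element is added to a list, or to a list in a list. *)
Class encoding (T : Type) := Encoding {
  enc : T -> tree;
  nrm : T -> nat;
  nrm_le : forall x, nrm x <= tree_size (enc x);
  size_enc : exists d, forall x, tree_size (enc x) <= (nrm x).+2 ^ d
}.

Lemma tree_size_gt0 t : 0 < tree_size t.
Proof. by case: t. Qed.

Lemma tree_size_enc_nat n : tree_size (enc_nat n) = n.*2.+1.
Proof. by elim: n => //= n ->; rewrite add1n. Qed.

Program Instance encoding_nat : encoding nat :=
  {| enc := enc_nat; nrm := fun n => n |}.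
Next Obligation. by move=> n; rewrite tree_size_enc_nat; lia. Qed.
Next Obligation.
by exists 2 => n; rewrite tree_size_enc_nat !expnS; nia.
Qed.

Program Instance encoding_bool : encoding bool :=
  {| enc := enc_bool; nrm := fun=> 0 |}.
Next Obligation. by []. Qed.
Next Obligation. by exists 2; case. Qed.

Program Instance encoding_unit : encoding unit :=
  {| enc := fun=> Leaf; nrm := fun=> 0 |}.
Next Obligation. by []. Qed.
Next Obligation. by exists 0; case. Qed.

Program Instance encoding_prod A B {eA : encoding A} {eB : encoding B} :
    encoding (A * B) :=
  {| enc := fun p => Node (enc p.1) (enc p.2);
     nrm := fun p => maxn (nrm p.1) (nrm p.2) |}.
Next Obligation.
by move=> A B eA eB [a b] /=; have := @nrm_le _ eA a; have := @nrm_le _ eB b; lia.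
Qed.
Next Obligation.
move=> A B eA eB; have [[d Ad] [e Be]] := (@size_enc A eA, @size_enc B eB).
have [f fP] : poly_bounded (fun n => (n.+2 ^ d + n.+2 ^ e).+1).
  by poly_bound; exact: poly_bounded_exp.
exists f => -[a b] /=; apply: leq_trans (fP _); rewrite ltnS leq_add //.
  apply: leq_trans (Ad a) _; case: (d) => // k.
  by rewrite leq_exp2r // !ltnS leq_maxl.
apply: leq_trans (Be b) _; case: (e) => // k.
by rewrite leq_exp2r // !ltnS leq_maxr.
Qed.

Lemma tree_size_enc_seq (T : Type) (f : T -> tree) s :
  tree_size (enc_seq f s) = (\sum_(x <- s) (tree_size (f x)).+1).+1.
Proof.
elim: s => [|x s IHs] /=; first by rewrite big_nil.
by rewrite IHs big_cons addSn addnS.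
Qed.

Program Instance encoding_seq T {eT : encoding T} : encoding (seq T) :=
  {| enc := enc_seq enc; nrm := fun s => maxn (size s) (\max_(x <- s) nrm x) |}.
Next Obligation.
move=> T eT s; elim: s => [|x s IHs] /=; first by rewrite big_nil.
by rewrite big_cons; move: IHs; have := @nrm_le _ eT x; lia.
Qed.
Next Obligation.
move=> T eT; have [d Td] := @size_enc T eT.
have [f fP] : poly_bounded (fun n => (n * (n.+2 ^ d).+1).+1).
  by poly_bound; exact: poly_bounded_exp.
exists f => s; apply: leq_trans (fP _).
rewrite tree_size_enc_seq ltnS.
set N := maxn _ _.
have [sN mN] : size s <= N /\ \max_(x <- s) nrm x <= N by rewrite leq_maxl leq_maxr.
clearbody N; apply: leq_trans _ (leq_mul sN (leqnn _)).
elim: s mN {sN} => [|x s IHs] /=; first by rewrite !big_nil.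
rewrite !big_cons geq_max mulSn => /andP[xN sN].
rewrite leq_add ?IHs // ltnS; apply: leq_trans (Td x) _.
by case: (d) => // k; rewrite leq_exp2r.
Qed.

Lemma nrm_prodE A B (eA : encoding A) (eB : encoding B) (p : A * B) :
  nrm p = maxn (nrm p.1) (nrm p.2).
Proof. by []. Qed.

Lemma nrm_seqE T (eT : encoding T) (s : seq T) :
  nrm s = maxn (size s) (\max_(x <- s) nrm x).
Proof. by []. Qed.

Lemma nrm_nil T (eT : encoding T) : nrm ([::] : seq T) = 0.
Proof. by rewrite nrm_seqE big_nil. Qed.

Lemma nrm_cat T (eT : encoding T) (s1 s2 : seq T) :
  nrm (s1 ++ s2) <= nrm s1 + nrm s2.
Proof. by rewrite !nrm_seqE size_cat big_cat /=; lia. Qed.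

Lemma nrm_catl T (eT : encoding T) (s1 s2 : seq T) : nrm s1 <= nrm (s1 ++ s2).
Proof. by rewrite !nrm_seqE size_cat big_cat /=; lia. Qed.

Lemma nrm_catr T (eT : encoding T) (s1 s2 : seq T) : nrm s2 <= nrm (s1 ++ s2).
Proof. by rewrite !nrm_seqE size_cat big_cat /=; lia. Qed.

Lemma nrm_cons T (eT : encoding T) x (s : seq T) :
  nrm (x :: s) = maxn (size s).+1 (maxn (nrm x) (\max_(y <- s) nrm y)).
Proof. by rewrite !nrm_seqE big_cons /=. Qed.

Lemma size_le_nrm T (eT : encoding T) (s : seq T) : size s <= nrm s.
Proof. by rewrite nrm_seqE leq_maxl. Qed.

(** Growth that is additive in each step stays polynomial under iteration; a constant factor per
    step would not. The step bound is asked only for elements of norm at most [R], which covers all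
    elements of the list. *)
Lemma nrm_foldl A T (eA : encoding A) (eT : encoding T)
    (f : A -> T -> A) (a : A) (s : seq T) (R G : nat) :
  (forall a t, nrm t <= R -> nrm (f a t) <= nrm a + G) ->
  nrm s <= R -> nrm (foldl f a s) <= nrm a + size s * G.
Proof.
move=> fG; elim: s a => [|t s IHs] a sR /=; first by rewrite addn0.
have tR : nrm t <= R by move: sR; rewrite nrm_cons; lia.
have sR' : nrm s <= R by move: sR; rewrite nrm_cons nrm_seqE; lia.
by apply: leq_trans (IHs _ sR') _; have := fG a t tR; lia.
Qed.

(** * Programs *)

(* [b] only bounds the running time, so that costs can be overestimated. *)
Definition run c s s' b := exists2 T, T <= b & exec c s T s'.

Lemma run_le c s s' b b' : b <= b' -> run c s s' b -> run c s s' b'.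
Proof. by move=> bb' [T Tb e]; exists T => //; apply: leq_trans bb'. Qed.

Lemma run_assign s x e : run (CAssign x e) s (update s x (eval s e)) (eval_cost s e).+1.
Proof. by exists (eval_cost s e).+1 => //; constructor. Qed.

Lemma run_seq c1 c2 s s1 s2 b1 b2 :
  run c1 s s1 b1 -> run c2 s1 s2 b2 -> run (CSeq c1 c2) s s2 (b1 + b2).+1.
Proof.
move=> [T1 T1b e1] [T2 T2b e2]; exists (T1 + T2).+1.
  by rewrite ltnS leq_add.
exact: ExecSeq e1 e2.
Qed.

Lemma updateE s x t y : update s x t y = if y == x then t else s y.
Proof. by []. Qed.

Lemma eval_le_cost s e : tree_size (eval s e) <= eval_cost s e.
Proof. by case: e => *; apply: leq_addr. Qed.

(** Writing a tree costs at least its size, so a variable that was assigned cannot hold more than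
    the time spent. *)
Lemma exec_size c s T s' y :
  exec c s T s' -> s' y = s y \/ tree_size (s' y) <= T.
Proof.
move=> ex; elim: ex y => {c s T s'}.
- by move=> s y; left.
- move=> s x e y; rewrite updateE; case: eqP => _; last by left.
  by right; apply: leq_trans (eval_le_cost _ _) (leqnSn _).
- move=> c1 c2 s s1 s2 T1 T2 _ IH1 _ IH2 y.
  by case: (IH2 y) => [->|]; [case: (IH1 y) => [->|]|]; [left|right; lia|right; lia].
- move=> e c1 c2 s s' T _ IH y; case: (IH y) => [->|]; first by left.
  by right; lia.
- by move=> e c s _ y; left.
- move=> e c s s1 s2 T1 T2 _ _ IH1 _ IH2 y.
  by case: (IH2 y) => [->|]; [case: (IH1 y) => [->|]|]; [left|right; lia|right; lia].
Qed.

(** Variables 1 to [m - 1] are scratch space; 0 is excluded because it carries the input. *)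
Definition clean m (s : store) := forall y, 0 < y < m -> s y = Leaf.

Lemma clean_le m m' s : m <= m' -> clean m' s -> clean m s.
Proof. by move=> mm' cs y /andP[y0 ym]; apply: cs; rewrite y0 (leq_trans ym). Qed.

Lemma clean_update0 m s t : clean m s -> clean m (update s 0 t).
Proof. by move=> cs [|y] // ym; rewrite updateE cs. Qed.

(* The final store agrees with the initial one except at 0, so that programs can
   be sequenced, and called with other data kept in the variables from [m] on. *)
Definition ptime_on X Y {eX : encoding X} {eY : encoding Y}
    (D : X -> Prop) (f : X -> Y) :=
  exists c m, exists2 B, poly_bounded B &
    forall x s, D x -> s 0 = enc x -> clean m s ->
      run c s (update s 0 (enc (f x))) (B (nrm x)).

Definition ptime X Y {eX : encoding X} {eY : encoding Y} (f : X -> Y) :=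
  ptime_on (fun=> True) f.

Section Closure.
Context X (eX : encoding X).

(** The time bound also bounds the output, so compositions need no separate size argument. If
    variable 0 was never changed, the output is the input. *)
Lemma ptime_on_nrm Y (eY : encoding Y) D (f : X -> Y) :
  ptime_on D f ->
  exists2 B, poly_bounded B & forall x, D x -> nrm (f x) <= B (nrm x).
Proof.
move=> [c [m [B pB cP]]]; have [d Xd] := @size_enc X eX.
exists (fun n => n.+2 ^ d + B n).
  by apply: poly_bounded_add pB; exact: poly_bounded_exp.
move=> x Dx; have := cP x (init_store (enc x)) Dx erefl.
case=> [y /andP[y0 _]|T TB /exec_size - /(_ 0)].
  by rewrite /init_store updateE; case: eqP y0 => // ->.
rewrite updateE eqxx => -[fx|fx]; apply: leq_trans (nrm_le _) _.
  by rewrite fx; apply: leq_trans (Xd x) (leq_addr _ _).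
by apply: leq_trans fx _; apply: leq_trans TB (leq_addl _ _).
Qed.

Lemma ptime_on_sub Y (eY : encoding Y) (D D' : X -> Prop) (f : X -> Y) :
  (forall x, D x -> D' x) -> ptime_on D' f -> ptime_on D f.
Proof.
move=> DD' [c [m [B pB cP]]]; exists c, m, B => // x s Dx.
exact: cP (DD' _ Dx).
Qed.

Lemma ptime_ptime_on Y (eY : encoding Y) (D : X -> Prop) (f : X -> Y) :
  ptime f -> ptime_on D f.
Proof. exact: ptime_on_sub. Qed.

(** A form convenient for combining programs: one bound dominates the input size, the output size
    and the time. *)
Lemma ptime_onE Y (eY : encoding Y) D (f : X -> Y) :
  ptime_on D f -> exists c m, exists2 B, poly_bounded B &
    forall x, D x ->
      [/\ tree_size (enc x) <= B (nrm x), tree_size (enc (f x)) <= B (nrm x)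
        & forall s, s 0 = enc x -> clean m s ->
            run c s (update s 0 (enc (f x))) (B (nrm x))].
Proof.
move=> pf; have [F pF fF] := ptime_on_nrm pf.
have [dX Xd] := @size_enc X eX; have [dY Yd] := @size_enc Y eY.
case: pf => [c [m [B pB cP]]].
exists c, m, (fun n => n.+2 ^ dX + (F n).+2 ^ dY + B n).
  by poly_bound; exact: poly_bounded_exp.
move=> x Dx; split; first by rewrite -addnA; apply: leq_trans (Xd x) (leq_addr _ _).
  rewrite addnAC; apply: leq_trans (Yd _) _; apply: leq_trans (leq_addl _ _).
  by case: (dY) => // k; rewrite leq_exp2r // !ltnS fF.
by move=> s s0 cs; apply: run_le (leq_addl _ _) (cP x s Dx s0 cs).
Qed.

(** * Functions computed by a single expression *)

Fixpoint var0_only e :=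
  match e with
  | EVar x => x == 0
  | ELeaf => true
  | EHd e | ETl e => var0_only e
  | ENode e1 e2 | EEq e1 e2 => var0_only e1 && var0_only e2
  end.

Lemma eval_var0 e s : var0_only e -> eval s e = eval (fun=> s 0) e.
Proof.
by elim: e => [x /eqP->|//|e1 IH1 e2 IH2 /andP[/IH1 ? /IH2 ?]|e IH /IH ?|e IH /IH ?|
  e1 IH1 e2 IH2 /andP[/IH1 ? /IH2 ?]] //=; congruence.
Qed.

Lemma eval_cost_bound e : var0_only e ->
  exists2 B, poly_bounded B & forall s, eval_cost s e <= B (tree_size (s 0)).
Proof.
have sz s e' : tree_size (enc_bool (tree_eqb (eval s e') (eval s e'))) <= 3.
  by case: tree_eqb.
elim: e => [x /eqP->||e1 IH1 e2 IH2 /andP[/IH1[B pB Bs] /IH2[C pC Cs]]|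
  e IH /IH[B pB Bs]|e IH /IH[B pB Bs]|
  e1 IH1 e2 IH2 /andP[/IH1[B pB Bs] /IH2[C pC Cs]]].
- by exists (fun n => n); [poly_bound|move=> s /=; lia].
- by exists (fun=> 1); [poly_bound|move=> s /=; lia].
- exists (fun n => ((B n + C n) + (B n + C n)).+1); first by poly_bound.
  move=> s /=; have := Bs s; have := Cs s.
  by have := eval_le_cost s e1; have := eval_le_cost s e2; lia.
- exists (fun n => B n + B n + 1); first by poly_bound.
  move=> s /=; have := Bs s; have := eval_le_cost s e.
  by case: (eval s e) => //= *; lia.
- exists (fun n => B n + B n + 1); first by poly_bound.
  move=> s /=; have := Bs s; have := eval_le_cost s e.
  by case: (eval s e) => //= *; lia.
- exists (fun n => 3 + (B n + C n)); first by poly_bound.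
  by move=> s /=; have := Bs s; have := Cs s; case: tree_eqb => /=; lia.
Qed.

Lemma ptime_expr Y (eY : encoding Y) (f : X -> Y) e :
  var0_only e -> (forall x, eval (fun=> enc x) e = enc (f x)) -> ptime f.
Proof.
move=> e0 ef; have [B pB Be] := eval_cost_bound e0.
have [d Xd] := @size_enc X eX.
have [k kP] := pB.
exists (CAssign 0 e), 0, (fun n => ((n.+2 ^ d).+2 ^ k).+1).
  by poly_bound; apply: poly_bounded_comp (poly_bounded_exp d); exact: poly_bounded_exp.
move=> x s _ s0 _; rewrite -ef -s0 -eval_var0 //.
apply: run_le (run_assign _ _ _); rewrite ltnS; apply: leq_trans (Be s) _.
apply: leq_trans (kP _) _; case: (k) => // j; rewrite leq_exp2r // !ltnS s0.
exact: Xd.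
Qed.

Lemma ptime_id : ptime (fun x : X => x).
Proof. exact: (@ptime_expr _ _ _ (EVar 0)). Qed.

Fixpoint expr_of t := if t is Node a b then ENode (expr_of a) (expr_of b) else ELeaf.

Lemma ptime_const Y (eY : encoding Y) (y : Y) : ptime (fun _ : X => y).
Proof.
apply: (@ptime_expr _ _ _ (expr_of (enc y))); first by elim: (enc y) => //= ? -> ? ->.
by move=> x; elim: (enc y) => //= ? -> ? ->.
Qed.

End Closure.

(** The second program is needed only where [f] lands. This is how an algorithm with a restricted
    class of inputs can be called as a subroutine. *)
Lemma ptime_on_comp X Y Z (eX : encoding X) (eY : encoding Y) (eZ : encoding Z)
    (D : X -> Prop) (E : Y -> Prop) (f : X -> Y) (g : Y -> Z) :
  (forall x, D x -> E (f x)) -> ptime_on E g -> ptime_on D f ->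
  ptime_on D (fun x => g (f x)).
Proof.
move=> DE [c2 [m2 [B2 [d2 pB2] cP2]]] pf; have [F pF fF] := ptime_on_nrm pf.
case: pf => [c1 [m1 [B1 pB1 cP1]]].
exists (CSeq c1 c2), (maxn m1 m2), (fun n => (B1 n + (F n).+2 ^ d2).+1).
  by poly_bound; apply: poly_bounded_comp pF; exact: poly_bounded_exp.
move=> x s Dx s0 cs; apply: run_le (run_seq (s1 := update s 0 (enc (f x)))
   (b1 := B1 (nrm x)) (b2 := B2 (nrm (f x))) _ _).
- rewrite ltnS leq_add2l; apply: leq_trans (pB2 _) _.
  by case: (d2) => // k; rewrite leq_exp2r // !ltnS fF.
- by apply: cP1 => //; apply: clean_le cs; rewrite leq_maxl.
- have -> : update s 0 (enc (g (f x))) =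
     update (update s 0 (enc (f x))) 0 (enc (g (f x))).
    by apply: funext => y; rewrite !updateE; case: eqP.
  apply: cP2 => //; first exact: DE.
  by apply/clean_update0/(clean_le _ cs); rewrite leq_maxr.
Qed.

Lemma ptime_comp X Y Z (eX : encoding X) (eY : encoding Y) (eZ : encoding Z)
    (g : Y -> Z) (f : X -> Y) :
  ptime g -> ptime f -> ptime (fun x => g (f x)).
Proof. exact: ptime_on_comp. Qed.

(** * Pairing, branching and folding as programs *)

Ltac store_simpl := rewrite ?updateE; repeat (case: eqP => ?; try lia => //).
Ltac store_eq := apply: funext => ?; store_simpl; try congruence.

(** The specification is for one fixed input tree, so that for a conditional only the branch taken
    has to be specified. *)
Definition program_for c m t t' b :=
  forall s, s 0 = t -> clean m s -> run c s (update s 0 t') b.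

Lemma program_for_le c m m' t t' b b' :
  m <= m' -> b <= b' -> program_for c m t t' b -> program_for c m' t t' b'.
Proof.
by move=> mm' bb' cP s s0 cs; apply: run_le bb' (cP s s0 _); apply: clean_le cs.
Qed.

(** Variable [m] keeps the input and [m.+1] the first result. Both lie above the scratch space of
    [c1] and [c2], which leave them alone, and both are erased at the end. *)
Definition pair_cmd c1 c2 m :=
  CSeq (CAssign m (EVar 0)) (CSeq c1 (CSeq (CAssign m.+1 (EVar 0))
  (CSeq (CAssign 0 (EVar m)) (CSeq c2 (CSeq (CAssign 0 (ENode (EVar m.+1) (EVar 0)))
  (CSeq (CAssign m ELeaf) (CAssign m.+1 ELeaf))))))).

Lemma program_for_pair c1 c2 m t t1 t2 b : 0 < m ->
  tree_size t <= b -> tree_size t1 <= b -> tree_size t2 <= b ->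
  program_for c1 m t t1 b -> program_for c2 m t t2 b ->
  program_for (pair_cmd c1 c2 m) m.+2 t (Node t1 t2) (20 * b + 30).
Proof.
move=> m0 tb t1b t2b c1P c2P s s0 cs.
have cm : s m = Leaf by apply: cs; lia.
have cm1 : s m.+1 = Leaf by apply: cs; lia.
pose s1 := update s m t; pose s2 := update s1 0 t1.
pose s3 := update s2 m.+1 t1; pose s4 := update s3 0 t.
pose s5 := update s4 0 t2; pose s6 := update s5 0 (Node t1 t2).
have cs' y : 0 < y < m -> s y = Leaf by move=> ym; apply: cs; lia.
have cs1 : clean m s1 by move=> y ym; rewrite -(cs' y ym) /s1; store_simpl.
have cs4 : clean m s4 by move=> y ym; rewrite -(cs' y ym) /s4 /s3 /s2 /s1; store_simpl.
have ra1 := run_assign s m (EVar 0); rewrite /= s0 -/s1 in ra1.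
have ra3 := run_assign s2 m.+1 (EVar 0); rewrite /= -/s3 in ra3.
have e3 : s3 m = t by rewrite /s3 /s2 /s1; store_simpl.
have ra4 := run_assign s3 0 (EVar m); rewrite /= e3 -/s4 in ra4.
have e5 : s5 m.+1 = t1 by rewrite /s5 /s4 /s3; store_simpl.
have ra6 := run_assign s5 0 (ENode (EVar m.+1) (EVar 0)).
rewrite /= e5 -/s6 in ra6.
have r1 : run c1 s1 s2 b by apply: c1P => //; rewrite /s1; store_simpl.
have r2 : run c2 s4 s5 b by apply: c2P.
have := run_seq ra1 (run_seq r1 (run_seq ra3 (run_seq ra4 (run_seq r2 (run_seq ra6
  (run_seq (run_assign _ m ELeaf) (run_assign _ m.+1 ELeaf))))))).
have -> : update (update s6 m Leaf) m.+1 Leaf = update s 0 (Node t1 t2).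
  by rewrite /s6 /s5 /s4 /s3 /s2 /s1; store_eq.
have e2 : s2 0 = t1 by [].
have e5' : s5 0 = t2 by [].
by apply: run_le => /=; rewrite e2 e5'; lia.
Qed.

Definition if_cmd cb c1 c2 m :=
  CSeq (CAssign m (EVar 0)) (CSeq cb (CSeq (CAssign m.+1 (EVar 0))
  (CSeq (CAssign 0 (EVar m)) (CSeq (CAssign m ELeaf)
  (CIf (EVar m.+1) (CSeq (CAssign m.+1 ELeaf) c1) (CSeq (CAssign m.+1 ELeaf) c2)))))).

Lemma program_for_if cb c1 c2 m t (bv : bool) t' b : 0 < m -> tree_size t <= b ->
  program_for cb m t (enc_bool bv) b ->
  program_for (if bv then c1 else c2) m t t' b ->
  program_for (if_cmd cb c1 c2 m) m.+2 t t' (20 * b + 50).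
Proof.
move=> m0 tb cbP cP s s0 cs.
have cm : s m = Leaf by apply: cs; lia.
have cm1 : s m.+1 = Leaf by apply: cs; lia.
pose tb1 := enc_bool bv; have tb1b : tree_size tb1 <= 3 by rewrite /tb1; case: (bv).
pose s1 := update s m t; pose s2 := update s1 0 tb1.
pose s3 := update s2 m.+1 tb1; pose s4 := update s3 0 t.
pose s5 := update s4 m Leaf; pose s6 := update s5 m.+1 Leaf.
(* Once both saved values are erased the store is the original one, so the specification of the
   branch applies to [s] itself. *)
have s6E : s6 = s.
  by rewrite /s6 /s5 /s4 /s3 /s2 /s1; store_eq.
have cs' y : 0 < y < m -> s y = Leaf by move=> ym; apply: cs; lia.
have cs1 : clean m s1 by move=> y ym; rewrite -(cs' y ym) /s1; store_simpl.
have ra1 := run_assign s m (EVar 0); rewrite /= s0 -/s1 in ra1.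
have ra3 := run_assign s2 m.+1 (EVar 0); rewrite /= -/s3 in ra3.
have e3 : s3 m = t by rewrite /s3 /s2 /s1; store_simpl.
have ra4 := run_assign s3 0 (EVar m); rewrite /= e3 -/s4 in ra4.
have e5 : s5 m.+1 = tb1 by rewrite /s5 /s4 /s3; store_simpl.
have rb : run cb s1 s2 b by apply: cbP => //; rewrite /s1; store_simpl.
have rc : run (if bv then c1 else c2) s (update s 0 t') b by apply: cP.
have := run_seq (run_assign s5 m.+1 ELeaf) (s2 := update s 0 t') (b2 := b).
rewrite /= -/s6 s6E => rc'.
have rif : run (CIf (EVar m.+1) (CSeq (CAssign m.+1 ELeaf) c1) (CSeq (CAssign m.+1 ELeaf) c2))
    s5 (update s 0 t') (b + 10).
  have [T Tb ex] := rc' _ rc; exists (eval_cost s5 (EVar m.+1) + T).+1.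
    by rewrite /= e5; lia.
  apply: ExecIf; rewrite /= e5; move: ex; rewrite /tb1.
  by case: (bv).
have := run_seq ra1 (run_seq rb (run_seq ra3 (run_seq ra4
  (run_seq (run_assign s4 m ELeaf) rif)))).
have e2 : s2 0 = tb1 by [].
by apply: run_le => /=; rewrite e2; lia.
Qed.

(** Variable [m] holds the rest of the list, [m.+1] the parameters common to all steps and [m.+2]
    the accumulator; variable 0 passes argument and result of [c]. *)
Definition fold_body c m :=
  CSeq (CAssign 0 (ENode (ENode (EVar m.+1) (EVar m.+2)) (EHd (EVar m))))
  (CSeq c (CSeq (CAssign m.+2 (EVar 0)) (CAssign m (ETl (EVar m))))).

Definition fold_cmd c m :=
  CSeq (CAssign m (ETl (EVar 0)))
  (CSeq (CAssign m.+1 (EHd (EHd (EVar 0))))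
  (CSeq (CAssign m.+2 (ETl (EHd (EVar 0))))
  (CSeq (CWhile (EVar m) (fold_body c m))
  (CSeq (CAssign 0 (EVar m.+2))
  (CSeq (CAssign m ELeaf) (CSeq (CAssign m.+1 ELeaf) (CAssign m.+2 ELeaf))))))).

Definition fold_store s m v l e a :=
  update (update (update (update s 0 v) m l) m.+1 e) m.+2 a.

(** Induction on the list from the front. Variable 0 holds a leftover of the last call, hence the
    arbitrary [v] before and the existential [v'] after the loop. *)
Lemma run_fold_while (A T : Type) (encA : A -> tree) (encT : T -> tree)
    c m s v e (f : A -> T -> A) (a : A) (l : seq T) b : 0 < m -> clean m s ->
  (forall l1 l2, l = l1 ++ l2 -> tree_size (encA (foldl f a l1)) <= b) ->
  tree_size (enc_seq encT l) <= b -> tree_size e <= b ->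
  (forall l1 t l2, l = l1 ++ t :: l2 ->
     program_for c m (Node (Node e (encA (foldl f a l1))) (encT t))
       (encA (foldl f a (rcons l1 t))) b) ->
  exists v', run (CWhile (EVar m) (fold_body c m))
    (fold_store s m v (enc_seq encT l) e (encA a))
    (fold_store s m v' Leaf e (encA (foldl f a l))) (size l * (30 * b + 30) + 10).
Proof.
move=> m0 cs; elim: l a v => [|t l IHl] a v ab lb eb cP.
  exists v; exists 2 => //.
  set st := fold_store _ _ _ _ _ _.
  have stm : st m = Leaf by rewrite /st /fold_store; store_simpl.
  have := @ExecWhileF (EVar m) (fold_body c m) st; rewrite /= stm; exact.
have [||||v' rv] := IHl (f a t) (encA (f a t)).
- by move=> l1 l2 El; apply: (ab (t :: l1) l2); rewrite El.
- by move: lb => /=; lia.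
- by [].
- by move=> l1 t' l2 El; apply: (cP (t :: l1) t' l2); rewrite El.
exists v'; pose st0 := fold_store s m v (enc_seq encT (t :: l)) e (encA a).
pose st1 := fold_store s m (Node (Node e (encA a)) (encT t)) (enc_seq encT (t :: l)) e (encA a).
pose st2 := fold_store s m (encA (f a t)) (enc_seq encT (t :: l)) e (encA a).
pose st3 := fold_store s m (encA (f a t)) (enc_seq encT (t :: l)) e (encA (f a t)).
pose st4 := fold_store s m (encA (f a t)) (enc_seq encT l) e (encA (f a t)).
have E0 : st0 m = enc_seq encT (t :: l) /\ st0 m.+1 = e /\ st0 m.+2 = encA a.
  by rewrite /st0 /fold_store; split; [|split]; store_simpl.
case: E0 => E01 [E02 E03].
have ra1 := run_assign st0 0 (ENode (ENode (EVar m.+1) (EVar m.+2)) (EHd (EVar m))).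
rewrite /= E01 E02 E03 /= in ra1.
have {}ra1 : run (CAssign 0 (ENode (ENode (EVar m.+1) (EVar m.+2)) (EHd (EVar m))))
    st0 st1 (9 * b + 10).
  have -> : st1 = update st0 0 (Node (Node e (encA a)) (encT t)).
    by rewrite /st1 /st0 /fold_store; store_eq.
  apply: run_le ra1; move: lb (ab [::] _ erefl) => /=; lia.
have rc : run c st1 st2 b.
  have -> : st2 = update st1 0 (encA (f a t)).
    by rewrite /st1 /st2 /fold_store; store_eq.
  apply: (cP [::] t l erefl); first by rewrite /st1 /fold_store; store_simpl.
  by move=> y ym; rewrite -(cs y ym) /st1 /fold_store; store_simpl.
have ra3 : run (CAssign m.+2 (EVar 0)) st2 st3 (b + 1).
  have E2 : st2 0 = encA (f a t) by rewrite /st2 /fold_store; store_simpl.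
  have -> : st3 = update st2 m.+2 (encA (f a t)).
    by rewrite /st3 /st2 /fold_store; store_eq.
  rewrite -E2; apply: run_le (run_assign st2 m.+2 (EVar 0)).
  by rewrite /= E2; move: (ab [:: t] _ erefl) => /=; lia.
have ra4 : run (CAssign m (ETl (EVar m))) st3 st4 (2 * b + 1).
  have E3 : st3 m = enc_seq encT (t :: l) by rewrite /st3 /fold_store; store_simpl.
  have -> : st4 = update st3 m (enc_seq encT l).
    by rewrite /st3 /st4 /fold_store; store_eq.
  have := run_assign st3 m (ETl (EVar m)); rewrite /= E3 /=; apply: run_le.
  by move: lb => /=; lia.
have [T1 T1b ex1] := run_seq ra1 (run_seq rc (run_seq ra3 ra4)).
case: rv => T2 T2b ex2.
have stm : truthy (eval st0 (EVar m)) by rewrite /= E01.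
exists (eval_cost st0 (EVar m) + T1 + T2).+1; last exact: ExecWhileT ex1 ex2.
by move: lb; rewrite /= E01 /= mulSn; lia.
Qed.

Lemma program_for_fold (A T : Type) (encA : A -> tree) (encT : T -> tree)
    c m e (f : A -> T -> A) (a : A) (l : seq T) b : 0 < m ->
  (forall l1 l2, l = l1 ++ l2 -> tree_size (encA (foldl f a l1)) <= b) ->
  tree_size (enc_seq encT l) <= b -> tree_size e <= b ->
  (forall l1 t l2, l = l1 ++ t :: l2 ->
     program_for c m (Node (Node e (encA (foldl f a l1))) (encT t))
       (encA (foldl f a (rcons l1 t))) b) ->
  program_for (fold_cmd c m) m.+3 (Node (Node e (encA a)) (enc_seq encT l))
    (encA (foldl f a l)) (b * (30 * b + 30) + 50 * b + 50).
Proof.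
move=> m0 ab lb eb cP s s0 cs.
have cm : s m = Leaf by apply: cs; lia.
have cm1 : s m.+1 = Leaf by apply: cs; lia.
have cm2 : s m.+2 = Leaf by apply: cs; lia.
have cs' : clean m s by apply: clean_le cs; lia.
pose v := Node (Node e (encA a)) (enc_seq encT l).
have vb : tree_size v <= 3 * b + 2 by rewrite /v /=; move: (ab [::] _ erefl) => /=; lia.
have [v' rw] := run_fold_while v m0 cs' ab lb eb cP.
pose s1 := update s m (enc_seq encT l); pose s2 := update s1 m.+1 e.
pose s3 := update s2 m.+2 (encA a).
have sv : s 0 = v by rewrite s0.
have s3E : fold_store s m v (enc_seq encT l) e (encA a) = s3.
  by rewrite /s3 /s2 /s1 /fold_store; store_eq.
rewrite s3E in rw.
have e1 : s1 0 = v by rewrite /s1; store_simpl.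
have e2 : s2 0 = v by rewrite /s2 /s1; store_simpl.
have ra1 : run (CAssign m (ETl (EVar 0))) s s1 (5 * b + 5).
  have := run_assign s m (ETl (EVar 0)); rewrite /= s0 /=; apply: run_le.
  by move: vb; rewrite /v /=; lia.
have ra2 : run (CAssign m.+1 (EHd (EHd (EVar 0)))) s1 s2 (9 * b + 9).
  have := run_assign s1 m.+1 (EHd (EHd (EVar 0))); rewrite /= e1 /=; apply: run_le.
  by move: vb; rewrite /v /=; lia.
have ra3 : run (CAssign m.+2 (ETl (EHd (EVar 0)))) s2 s3 (9 * b + 9).
  have := run_assign s2 m.+2 (ETl (EHd (EVar 0))); rewrite /= e2 /=; apply: run_le.
  by move: vb; rewrite /v /=; lia.
set st := fold_store s m v' Leaf e (encA (foldl f a l)) in rw.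
have est : st m.+2 = encA (foldl f a l) by rewrite /st /fold_store; store_simpl.
have := run_seq ra1 (run_seq ra2 (run_seq ra3 (run_seq rw (run_seq (run_assign _ 0 (EVar m.+2))
  (run_seq (run_assign _ m ELeaf)
  (run_seq (run_assign _ m.+1 ELeaf) (run_assign _ m.+2 ELeaf))))))).
rewrite /= est.
set st' := update _ _ _; have -> : st' = update s 0 (encA (foldl f a l)).
  by rewrite /st' /st /fold_store; store_eq.
apply: run_le.
have lsz : size l <= b.
  by apply: leq_trans _ lb; elim: (l) => //= x l'; have := tree_size_gt0 (encT x); lia.
have := ab l [::] (esym (cats0 l)).
have := leq_mul lsz (leqnn (30 * b + 30)); lia.
Qed.

Lemma ptime_on_pair X Y Z (eX : encoding X) (eY : encoding Y) (eZ : encoding Z)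
    (D : X -> Prop) (f : X -> Y) (g : X -> Z) :
  ptime_on D f -> ptime_on D g -> ptime_on D (fun x => (f x, g x)).
Proof.
move=> /ptime_onE[c1 [m1 [B1 pB1 cP1]]] /ptime_onE[c2 [m2 [B2 pB2 cP2]]].
pose m := maxn 1 (maxn m1 m2); have m0 : 0 < m by rewrite leq_max.
exists (pair_cmd c1 c2 m), m.+2, (fun n => 20 * (B1 n + B2 n) + 30); first by poly_bound.
move=> x s Dx; have [szx szf r1] := cP1 x Dx; have [_ szg r2] := cP2 x Dx.
apply: program_for_pair => //; do ?[exact: leq_trans (leq_addr _ _) | exact: leq_trans (leq_addl _ _)].
  by apply: program_for_le r1; rewrite ?leq_addr // /m; lia.
by apply: program_for_le r2; rewrite ?leq_addl // /m; lia.
Qed.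

Lemma ptime_pair X Y Z (eX : encoding X) (eY : encoding Y) (eZ : encoding Z)
    (f : X -> Y) (g : X -> Z) :
  ptime f -> ptime g -> ptime (fun x => (f x, g x)).
Proof. exact: ptime_on_pair. Qed.

Lemma ptime_if X Y (eX : encoding X) (eY : encoding Y)
    (b : X -> bool) (f g : X -> Y) :
  ptime b -> ptime f -> ptime g -> ptime (fun x => if b x then f x else g x).
Proof.
move=> /ptime_onE[cb [mb [B pB bP]]] /ptime_onE[c1 [m1 [B1 pB1 cP1]]].
move=> /ptime_onE[c2 [m2 [B2 pB2 cP2]]].
pose m := maxn 1 (maxn mb (maxn m1 m2)); have m0 : 0 < m by rewrite leq_max.
exists (if_cmd cb c1 c2 m), m.+2, (fun n => 20 * (B n + B1 n + B2 n) + 50).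
  by poly_bound.
move=> x s _; have [szx _ rb] := bP x I; have [_ _ r1] := cP1 x I.
have [_ _ r2] := cP2 x I.
apply: (program_for_if (bv := b x)) => //; first lia.
  by apply: program_for_le rb; [rewrite /m; lia | rewrite -addnA leq_addr].
case: ifP => _; first by apply: program_for_le r1; rewrite /m; lia.
by apply: program_for_le r2; rewrite /m; lia.
Qed.

(** The growth bound refers to elements of [l x], so the list in the input is tied to [l] by the
    domain. *)
Lemma ptime_foldl_on X A T (eX : encoding X) (eA : encoding A) (eT : encoding T)
    (f : X -> A -> T -> A) (l : X -> seq T) :
  ptime (fun p : X * A * T => f p.1.1 p.1.2 p.2) ->
  (exists2 G, poly_bounded G & forall x a t,
     nrm t <= nrm (l x) -> nrm (f x a t) <= nrm a + G (nrm x)) ->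
  ptime_on (fun p : X * A * seq T => p.2 = l p.1.1)
    (fun p => foldl (f p.1.1) p.1.2 p.2).
Proof.
move=> [c [m [B [k Bk] cP]]] [G [g Gg] Gf].
have [dX Xd] := @size_enc X eX; have [dA Ad] := @size_enc A eA.
have [dL Ld] := @size_enc (seq T) _.
(* This bounds every intermediate accumulator: it starts at norm at most [n], and each of at most
   [n] steps adds at most [n.+2 ^ g]. *)
pose N n := n + n * n.+2 ^ g.
pose b n := (N n).+2 ^ k + (N n).+2 ^ dX + (N n).+2 ^ dA + (N n).+2 ^ dL.
have pN : poly_bounded N.
  by rewrite /N; poly_bound; exact: poly_bounded_exp.
have pb : poly_bounded b by rewrite /b; poly_bound.
exists (fold_cmd c m.+1), m.+4, (fun n => b n * (30 * b n + 30) + 50 * b n + 50).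
  by poly_bound.
move=> [[x a] l0] s /= ->; set n := maxn _ _.
have pow_le (y n' d d' : nat) : y <= n'.+2 ^ d -> n' <= N n -> (N n).+2 ^ d <= d' ->
    y <= d'.
  move=> yn' n'N; apply: leq_trans; apply: leq_trans yn' _.
  by case: (d) => // d1; rewrite leq_exp2r.
have xn : nrm x <= n by rewrite /n; lia.
have an : nrm a <= n by rewrite /n; lia.
have ln : nrm (l x) <= n by rewrite /n nrm_seqE leq_maxr.
have nN : n <= N n by rewrite /N leq_addr.
have accN l1 l2 : l x = l1 ++ l2 -> nrm (foldl (f x) a l1) <= N n.
  move=> El; have l1n : nrm l1 <= nrm (l x) by rewrite El nrm_catl.
  apply: leq_trans (nrm_foldl (f := f x) (G := G (nrm x)) (R := nrm (l x)) _ _ l1n) _.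
    exact: Gf.
  rewrite /N leq_add // leq_mul //.
    exact: leq_trans (@size_le_nrm _ eT _) (leq_trans l1n ln).
  by apply: leq_trans (Gg _) _; case: (g) => // g1; rewrite leq_exp2r.
apply: program_for_fold => //.
- move=> l1 l2 El; apply: pow_le (Ad _) (accN l1 l2 El) _; rewrite /b; lia.
- by apply: pow_le (Ld (l x)) (leq_trans ln nN) _; rewrite /b; lia.
- by apply: pow_le (Xd _) (leq_trans xn nN) _; rewrite /b; lia.
move=> l1 t l2 El; rewrite -cats1 foldl_cat /=.
apply: (@program_for_le _ m _ _ _ (B (nrm (x, foldl (f x) a l1, t)))) => //.
  apply: pow_le (Bk _) _ _; last by rewrite /b; lia.
  have tn : nrm t <= n.
    apply: leq_trans ln; rewrite El; apply: leq_trans (nrm_catr _ _ _).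
    by rewrite nrm_cons; lia.
  rewrite !nrm_prodE /=; have := accN l1 (t :: l2) El; lia.
by move=> s1 s10 cs1; apply: cP.
Qed.

Lemma ptime_foldl X A T (eX : encoding X) (eA : encoding A) (eT : encoding T)
    (f : X -> A -> T -> A) (a : X -> A) (l : X -> seq T) :
  ptime (fun p : X * A * T => f p.1.1 p.1.2 p.2) -> ptime a -> ptime l ->
  (exists2 G, poly_bounded G & forall x a t,
     nrm t <= nrm (l x) -> nrm (f x a t) <= nrm a + G (nrm x)) ->
  ptime (fun x => foldl (f x) (a x) (l x)).
Proof.
move=> pf pa pl growth.
have p := ptime_foldl_on pf growth.
apply: (ptime_on_comp (f := fun x => ((x, a x), l x)) _ p) => //.
by do !apply: ptime_pair => //; apply: ptime_id.
Qed.

(** * Running a given algorithm inside a larger program *)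

Fixpoint expr_bound e :=
  match e with
  | EVar x => x.+1
  | ELeaf => 0
  | EHd e | ETl e => expr_bound e
  | ENode e1 e2 | EEq e1 e2 => maxn (expr_bound e1) (expr_bound e2)
  end.

Fixpoint cmd_bound c :=
  match c with
  | CSkip => 0
  | CAssign x e => maxn x.+1 (expr_bound e)
  | CSeq c1 c2 => maxn (cmd_bound c1) (cmd_bound c2)
  | CIf e c1 c2 => maxn (expr_bound e) (maxn (cmd_bound c1) (cmd_bound c2))
  | CWhile e c => maxn (expr_bound e) (cmd_bound c)
  end.

Lemma eval_agree m e s r : expr_bound e <= m -> (forall y, y < m -> r y = s y) ->
  eval r e = eval s e /\ eval_cost r e = eval_cost s e.
Proof.
move=> em rs; elim: e em => [x|//|e1 IH1 e2 IH2|e IH|e IH|e1 IH1 e2 IH2] /=.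
- by move=> xm; rewrite rs.
- by rewrite geq_max => /andP[/IH1[-> ->] /IH2[-> ->]].
- by move=> /IH[-> ->].
- by move=> /IH[-> ->].
- by rewrite geq_max => /andP[/IH1[-> ->] /IH2[-> ->]].
Qed.

(** A program cannot see variables above those it mentions: in a store that agrees below [m] it
    makes the same run in the same time and leaves the rest untouched. *)
Lemma exec_frame m c s T s' r : exec c s T s' -> cmd_bound c <= m ->
  (forall y, y < m -> r y = s y) ->
  exists2 r', exec c r T r' &
    (forall y, y < m -> r' y = s' y) /\ (forall y, m <= y -> r' y = r y).
Proof.
move=> ex; elim: ex r => {c s T s'}.
- by move=> s r _ rs; exists r => //; constructor.
- move=> s x e r /=; rewrite geq_max => /andP[xm em] rs.
  have [ee ec] := eval_agree em rs.
  exists (update r x (eval r e)); first by rewrite -ec; constructor.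
  by split=> y ym; rewrite !updateE; case: eqP => // ?; [rewrite rs|lia].
- move=> c1 c2 s s1 s2 T1 T2 _ IH1 _ IH2 r /=; rewrite geq_max => /andP[c1m c2m] rs.
  have [r1 ex1 [lo1 hi1]] := IH1 r c1m rs.
  have [r2 ex2 [lo2 hi2]] := IH2 r1 c2m lo1.
  exists r2; first exact: ExecSeq ex1 ex2.
  by split=> // y ym; rewrite hi2 // hi1.
- move=> e c1 c2 s s' T _ IH r /=; rewrite !geq_max => /and3P[em c1m c2m] rs.
  have [ee ec] := eval_agree em rs.
  have [|r' ex' r'P] := IH r _ rs; first by case: ifP.
  by exists r' => //; rewrite -ec; apply: ExecIf; rewrite ee.
- move=> e c s ef r /=; rewrite geq_max => /andP[em cm] rs.
  have [ee ec] := eval_agree em rs.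
  by exists r; [rewrite -ec; apply: ExecWhileF; rewrite ee | split].
- move=> e c s s1 s2 T1 T2 et _ IH1 _ IH2 r cm rs.
  have [em c1m] : expr_bound e <= m /\ cmd_bound c <= m.
    by move: cm => /=; rewrite geq_max => /andP[].
  have [ee ec] := eval_agree em rs.
  have [r1 ex1 [lo1 hi1]] := IH1 r c1m rs.
  have [r2 ex2 [lo2 hi2]] := IH2 r1 cm lo1.
  exists r2; first by rewrite -ec; apply: ExecWhileT ex1 ex2; rewrite ee.
  by split=> // y ym; rewrite hi2 // hi1.
Qed.

Fixpoint clear_cmd m :=
  if m is m'.+1 then CSeq (CAssign m ELeaf) (clear_cmd m') else CSkip.

Lemma run_clear m s :
  run (clear_cmd m) s (fun y => if 0 < y <= m then Leaf else s y) (4 * m + 1).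
Proof.
elim: m s => [|m IHm] s /=.
  exists 1 => //; set s' := fun _ => _; have -> : s' = s; last by constructor.
  by apply: funext => y; rewrite /s'; case: y.
have := run_seq (run_assign s m.+1 ELeaf) (IHm _).
set s1 := (X in run _ _ X _); set s2 := (X in _ -> run _ _ X _).
have -> : s1 = s2.
  apply: funext => y; rewrite /s1 /s2 updateE /=.
  by case: eqP => [->|ym]; rewrite ?ltnn ?leqnn //; do !case: ifP => //; lia.
by apply: run_le => /=; lia.
Qed.

(** [computes_in] starts from an empty store and may leave anything behind outside variable 0. The
    frame property handles the larger store, and erasing the variables of [c] afterwards restores
    it. *)
Lemma ptime_on_of_program X Y (eX : encoding X) (eY : encoding Y)
    (D : X -> Prop) (f : X -> Y) c B :
  poly_bounded B ->
  (forall x, D x -> exists2 T, T <= B (nrm x) & computes_in c (enc x) T (enc (f x))) ->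
  ptime_on D f.
Proof.
move=> pB cP; pose m := (cmd_bound c).+1.
exists (CSeq c (clear_cmd m)), m.+1, (fun n => B n + 4 * m + 10); first by poly_bound.
move=> x s Dx s0 cs; have [T TB [s' ex s'0]] := cP x Dx.
have [||r ex' [lo hi]] := exec_frame (r := s) (m := m) ex; first by rewrite /m.
  move=> [|y] ym; rewrite /init_store updateE //= cs //; lia.
have := run_seq (ex_intro2 _ _ T TB ex' : run c s r _) (run_clear m r).
set s1 := (X in run _ _ X _); have -> : s1 = update s 0 (enc (f x)).
  apply: funext => y; rewrite /s1 updateE; case: eqP => [->|y0] /=.
    by rewrite lo.
  by case: ifP => ym; [rewrite cs //; lia | rewrite hi //; lia].
by apply: run_le => /=; lia.
Qed.

(** * Polynomial-time list functions *)

Definition poly_nrm X (eX : encoding X) (g : X -> nat) :=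
  exists2 B, poly_bounded B & forall x, g x <= B (nrm x).

Section Library.
Context X (eX : encoding X).

Lemma ptime_nrm Y (eY : encoding Y) (f : X -> Y) :
  ptime f -> exists2 B, poly_bounded B & forall x, nrm (f x) <= B (nrm x).
Proof.
by move=> /ptime_on_nrm[B pB fB]; exists B => // x; apply: fB.
Qed.

Lemma poly_nrm_ptime Y (eY : encoding Y) (f : X -> Y) :
  ptime f -> poly_nrm eX (fun x => nrm (f x)).
Proof. exact: ptime_nrm. Qed.

Lemma poly_nrm_nat (f : X -> nat) : ptime f -> poly_nrm eX f.
Proof. exact: ptime_nrm. Qed.

Lemma poly_nrm_const c : poly_nrm eX (fun=> c).
Proof. by exists (fun=> c) => //; poly_bound. Qed.

Lemma poly_nrm_add (f g : X -> nat) :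
  poly_nrm eX f -> poly_nrm eX g -> poly_nrm eX (fun x => f x + g x).
Proof.
move=> [B pB fB] [C pC gC]; exists (fun n => B n + C n); first by poly_bound.
by move=> x; apply: leq_add.
Qed.

Lemma poly_nrm_mul (f g : X -> nat) :
  poly_nrm eX f -> poly_nrm eX g -> poly_nrm eX (fun x => f x * g x).
Proof.
move=> [B pB fB] [C pC gC]; exists (fun n => B n * C n); first by poly_bound.
by move=> x; apply: leq_mul.
Qed.

Lemma ptime_eq Y (eY : encoding Y) (f g : X -> Y) : f =1 g -> ptime f -> ptime g.
Proof. by move=> /funext ->. Qed.

Lemma ptime_comp2 Y1 Y2 Z (e1 : encoding Y1) (e2 : encoding Y2) (eZ : encoding Z)
    (h : Y1 -> Y2 -> Z) (f : X -> Y1) (g : X -> Y2) :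
  ptime (fun p : Y1 * Y2 => h p.1 p.2) -> ptime f -> ptime g ->
  ptime (fun x => h (f x) (g x)).
Proof. by move=> ph pf pg; exact: (ptime_comp ph (ptime_pair pf pg)). Qed.

Lemma ptime_fst Y Z (eY : encoding Y) (eZ : encoding Z) (f : X -> Y * Z) :
  ptime f -> ptime (fun x => (f x).1).
Proof. by apply: (ptime_comp (g := fst)); exact: (@ptime_expr _ _ _ _ _ (EHd (EVar 0))). Qed.

Lemma ptime_snd Y Z (eY : encoding Y) (eZ : encoding Z) (f : X -> Y * Z) :
  ptime f -> ptime (fun x => (f x).2).
Proof. by apply: (ptime_comp (g := snd)); exact: (@ptime_expr _ _ _ _ _ (ETl (EVar 0))). Qed.

Lemma ptime_succ (f : X -> nat) : ptime f -> ptime (fun x => (f x).+1).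
Proof.
apply: (ptime_comp (g := S)).
exact: (@ptime_expr _ _ _ _ _ (ENode ELeaf (EVar 0))).
Qed.

Lemma ptime_pred (f : X -> nat) : ptime f -> ptime (fun x => (f x).-1).
Proof.
apply: (ptime_comp (g := predn)).
by apply: (@ptime_expr _ _ _ _ _ (ETl (EVar 0))) => // -[].
Qed.

Lemma ptime_cons Y (eY : encoding Y) (f : X -> Y) (g : X -> seq Y) :
  ptime f -> ptime g -> ptime (fun x => f x :: g x).
Proof.
apply: ptime_comp2; exact: (@ptime_expr _ _ _ _ _ (ENode (EHd (EVar 0)) (ETl (EVar 0)))).
Qed.

Lemma ptime_behead Y (eY : encoding Y) (f : X -> seq Y) :
  ptime f -> ptime (fun x => behead (f x)).
Proof.
apply: (ptime_comp (g := behead)).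
by apply: (@ptime_expr _ _ _ _ _ (ETl (EVar 0))) => // -[].
Qed.

Lemma ptime_nilp Y (eY : encoding Y) (f : X -> seq Y) :
  ptime f -> ptime (fun x => nilp (f x)).
Proof.
apply: (ptime_comp (g := fun s => nilp s)).
by apply: (@ptime_expr _ _ _ _ _ (EEq (EVar 0) ELeaf)) => // -[].
Qed.

(** A unary number and a list of units are the same tree, which turns iteration into a fold at no
    cost. *)
Lemma enc_nseq_unit n : enc (nseq n tt) = enc n.
Proof. by elim: n => //= n; rewrite /enc /= => ->. Qed.

Lemma ptime_nseq_unit (n : X -> nat) : ptime n -> ptime (fun x => nseq (n x) tt).
Proof.
apply: (ptime_comp (g := nseq^~ tt)).
by apply: (@ptime_expr _ _ _ _ _ (EVar 0)) => // n'; rewrite enc_nseq_unit.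
Qed.

End Library.

#[global] Hint Extern 0 (ptime (fun x => x)) => apply: ptime_id : ptime.
#[global] Hint Extern 0 (ptime (fun=> ?c)) => apply: ptime_const : ptime.
#[global] Hint Extern 1 (ptime (fun x => fst _)) => apply: ptime_fst : ptime.
#[global] Hint Extern 1 (ptime fst) => apply: ptime_fst : ptime.
#[global] Hint Extern 1 (ptime (fun x => snd _)) => apply: ptime_snd : ptime.
#[global] Hint Extern 1 (ptime snd) => apply: ptime_snd : ptime.
#[global] Hint Extern 1 (ptime (fun x => (_, _))) => apply: ptime_pair : ptime.
#[global] Hint Extern 1 (ptime (fun x => S _)) => apply: ptime_succ : ptime.
#[global] Hint Extern 1 (ptime (fun x => predn _)) => apply: ptime_pred : ptime.
#[global] Hint Extern 1 (ptime (fun x => _ :: _)) => apply: ptime_cons : ptime.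
#[global] Hint Extern 1 (ptime (fun x => behead _)) => apply: ptime_behead : ptime.
#[global] Hint Extern 1 (ptime (fun x => nilp _)) => apply: ptime_nilp : ptime.
#[global] Hint Extern 1 (ptime (fun x => if _ then _ else _)) => apply: ptime_if : ptime.
#[global] Hint Extern 1 (ptime (fun x => nseq _ tt)) => apply: ptime_nseq_unit : ptime.
#[global] Hint Extern 2 (ptime (fun x => ?f _)) =>
  is_var f; match goal with H : ptime f |- _ => apply: (ptime_comp H) end : ptime.
#[global] Hint Extern 2 (ptime (fun x => ?f _ _)) =>
  is_var f; match goal with H : ptime (fun p => f p.1 p.2) |- _ => apply: (ptime_comp2 H) end : ptime.
#[global] Hint Extern 0 (poly_nrm _ (fun=> _)) => apply: poly_nrm_const : ptime.

Ltac ptime_auto := auto 200 with ptime nocore.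

Lemma ptime_foldl_growth X A T (eX : encoding X) (eA : encoding A) (eT : encoding T)
    (f : X -> A -> T -> A) (a : X -> A) (l : X -> seq T) (g : X -> nat) :
  ptime (fun p : X * A * T => f p.1.1 p.1.2 p.2) -> ptime a -> ptime l ->
  poly_nrm eX g ->
  (forall x a t, nrm t <= nrm (l x) -> nrm (f x a t) <= nrm a + g x) ->
  ptime (fun x => foldl (f x) (a x) (l x)).
Proof.
move=> pf pa pl [B pB gB] fg; apply: ptime_foldl => //.
exists B => // x b t tl; apply: leq_trans (fg x b t tl) _.
by rewrite leq_add2l; apply: gB.
Qed.

Lemma ptime_iter X A (eX : encoding X) (eA : encoding A) (f : X -> A -> A)
    (a : X -> A) (n g : X -> nat) :
  ptime (fun p : X * A => f p.1 p.2) -> ptime a -> ptime n -> poly_nrm eX g ->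
  (forall x a, nrm (f x a) <= nrm a + g x) ->
  ptime (fun x => iter (n x) (f x) (a x)).
Proof.
move=> pf pa pn pg fg.
apply: (@ptime_eq _ _ _ _ (fun x => foldl (fun a (_ : unit) => f x a) (a x) (nseq (n x) tt))).
  by move=> x; elim: (n x) (a x) => //= k IHk b; rewrite IHk -iterSr.
apply: (ptime_foldl_growth (f := fun x a _ => f x a) (g := g)) => //.
by ptime_auto.
by ptime_auto.
Qed.

Section Library2.
Context X (eX : encoding X).

Lemma ptime_addn (f g : X -> nat) : ptime f -> ptime g -> ptime (fun x => f x + g x).
Proof.
apply: ptime_comp2; apply: (@ptime_eq _ _ _ _ (fun p : nat * nat => iter p.1 S p.2)).
  by move=> [m n] /=; elim: m => //= m ->.
by apply: (ptime_iter (g := fun=> 1)) => *; ptime_auto; rewrite /= addn1.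
Qed.

Lemma ptime_subn (f g : X -> nat) : ptime f -> ptime g -> ptime (fun x => f x - g x).
Proof.
apply: ptime_comp2; apply: (@ptime_eq _ _ _ _ (fun p : nat * nat => iter p.2 predn p.1)).
  by move=> [m n] /=; elim: n => [|n /= ->]; rewrite ?subn0 ?subnS.
by apply: (ptime_iter (g := fun=> 0)) => *; ptime_auto; rewrite /=; lia.
Qed.

Lemma ptime_negb (f : X -> bool) : ptime f -> ptime (fun x => ~~ f x).
Proof. by move=> pf; apply: ptime_if; ptime_auto. Qed.

Lemma ptime_andb (f g : X -> bool) : ptime f -> ptime g -> ptime (fun x => f x && g x).
Proof. by move=> pf pg; apply: ptime_if; ptime_auto. Qed.

Lemma ptime_orb (f g : X -> bool) : ptime f -> ptime g -> ptime (fun x => f x || g x).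
Proof. by move=> pf pg; apply: ptime_if; ptime_auto. Qed.

Lemma tree_eqb_enc_nat m n : tree_eqb (enc_nat m) (enc_nat n) = (m == n).
Proof. by elim: m n => [|m IHm] [|n] //=; rewrite IHm. Qed.

Lemma ptime_eqn (f g : X -> nat) : ptime f -> ptime g -> ptime (fun x => f x == g x).
Proof.
apply: ptime_comp2.
apply: (@ptime_expr _ _ _ _ _ (EEq (EHd (EVar 0)) (ETl (EVar 0)))) => // -[m n] /=.
by rewrite tree_eqb_enc_nat.
Qed.

Lemma ptime_leq (f g : X -> nat) : ptime f -> ptime g -> ptime (fun x => f x <= g x).
Proof.
by move=> pf pg; rewrite /leq; apply: ptime_eqn; [apply: ptime_subn|apply: ptime_const].
Qed.

Lemma nrm_rev T (eT : encoding T) (s : seq T) : nrm (rev s) = nrm s.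
Proof. by rewrite !nrm_seqE size_rev big_rev. Qed.

Lemma ptime_catrev T (eT : encoding T) (f g : X -> seq T) :
  ptime f -> ptime g -> ptime (fun x => catrev (f x) (g x)).
Proof.
apply: ptime_comp2.
apply: (@ptime_eq _ _ _ _ (fun p : seq T * seq T => foldl (fun s t => t :: s) p.2 p.1)).
  by move=> [s1 s2] /=; elim: s1 s2 => //= x s1 IHs1 s2; rewrite IHs1.
apply: (ptime_foldl (f := fun _ s t => t :: s)); try by ptime_auto.
exists succn; first by poly_bound.
move=> p a t; rewrite nrm_cons => tp; have : nrm p.1 <= nrm p by rewrite nrm_prodE; lia.
by move: tp; rewrite !(nrm_seqE _ a); lia.
Qed.

Lemma ptime_rev T (eT : encoding T) (f : X -> seq T) :
  ptime f -> ptime (fun x => rev (f x)).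
Proof. by move=> pf; apply: ptime_catrev => //; apply: ptime_const. Qed.

Lemma ptime_cat T (eT : encoding T) (f g : X -> seq T) :
  ptime f -> ptime g -> ptime (fun x => f x ++ g x).
Proof.
move=> pf pg; apply: (ptime_eq (f := fun x => catrev (rev (f x)) (g x))).
  by move=> x; rewrite catrevE revK.
by apply: ptime_catrev => //; apply: ptime_rev.
Qed.

Lemma ptime_head T (eT : encoding T) (y0 : T) (f : X -> seq T) :
  ptime f -> ptime (fun x => head y0 (f x)).
Proof.
move=> pf; apply: (ptime_eq (f := fun x => foldl (fun _ t => t) y0 (rev (f x)))).
  move=> x; rewrite -[RHS]/(head y0 (f x)); rewrite -{2}(revK (f x)).
  by case/lastP: (rev (f x)) => //= s t; rewrite -cats1 foldl_cat /= cats1 rev_rcons.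
apply: (ptime_foldl (f := fun _ _ t => t)); try by ptime_auto.
  exact: ptime_rev.
have [B pB fB] := ptime_nrm pf; exists B => // x a t tx.
by apply: leq_trans tx _; rewrite nrm_rev; apply: leq_trans (fB x) (leq_addl _ _).
Qed.

End Library2.

#[global] Hint Extern 1 (ptime (fun x => addn _ _)) => apply: ptime_addn : ptime.
#[global] Hint Extern 1 (ptime (fun x => subn _ _)) => apply: ptime_subn : ptime.
#[global] Hint Extern 1 (ptime (fun x => negb _)) => apply: ptime_negb : ptime.
#[global] Hint Extern 1 (ptime (fun x => andb _ _)) => apply: ptime_andb : ptime.
#[global] Hint Extern 1 (ptime (fun x => orb _ _)) => apply: ptime_orb : ptime.
#[global] Hint Extern 1 (ptime (fun x => eq_op _ _)) => apply: ptime_eqn : ptime.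
#[global] Hint Extern 1 (ptime (fun x => leq _ _)) => apply: ptime_leq : ptime.
#[global] Hint Extern 1 (ptime (fun x => rev _)) => apply: ptime_rev : ptime.
#[global] Hint Extern 1 (ptime (fun x => cat _ _)) => apply: ptime_cat : ptime.
#[global] Hint Extern 1 (ptime (fun x => head _ _)) => apply: ptime_head : ptime.

Section Library3.
Context X (eX : encoding X).

Lemma ptime_muln (f g : X -> nat) : ptime f -> ptime g -> ptime (fun x => f x * g x).
Proof.
apply: ptime_comp2; apply: (@ptime_eq _ _ _ _ (fun p : nat * nat => iter p.1 (addn p.2) 0)).
  by move=> [m n]; rewrite iter_addn_0 mulnC.
apply: (ptime_iter (f := fun p a => p.2 + a) (g := snd)); try by ptime_auto.
  by apply: poly_nrm_nat; ptime_auto.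
by move=> x a; rewrite addnC.
Qed.

Lemma ptime_drop T (eT : encoding T) (n : X -> nat) (f : X -> seq T) :
  ptime n -> ptime f -> ptime (fun x => drop (n x) (f x)).
Proof.
apply: ptime_comp2.
apply: (@ptime_eq _ _ _ _ (fun p : nat * seq T => iter p.1 behead p.2)).
  by move=> [m s] /=; elim: m s => [|m IHm] s; rewrite ?drop0 // iterSr IHm; case: s.
apply: (ptime_iter (f := fun _ s => behead s) (g := fun=> 0)); try by ptime_auto.
by move=> _ a; rewrite addn0 !nrm_seqE; case: a => //= t s; rewrite big_cons; lia.
Qed.

Lemma ptime_nth T (eT : encoding T) (y0 : T) (f : X -> seq T) (n : X -> nat) :
  ptime f -> ptime n -> ptime (fun x => nth y0 (f x) (n x)).
Proof.
move=> pf pn; apply: (ptime_eq (f := fun x => head y0 (drop (n x) (f x)))).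
  by move=> x; elim: (f x) (n x) => [|t s IHs] [|n'] //=.
by apply: ptime_head; apply: ptime_drop.
Qed.

Lemma ptime_size T (eT : encoding T) (f : X -> seq T) :
  ptime f -> ptime (fun x => size (f x)).
Proof.
move=> pf; apply: (ptime_eq (f := fun x => foldl (fun n _ => n.+1) 0 (f x))).
  by move=> x; rewrite -[RHS]add0n; elim: (f x) 0 => //= *; rewrite ?addn0 // addnS -addSn.
apply: (ptime_foldl_growth (f := fun _ n _ => n.+1) (g := fun=> 1)); ptime_auto.
by move=> *; rewrite /nrm /=; lia.
Qed.

Lemma ptime_take T (eT : encoding T) (n : X -> nat) (f : X -> seq T) :
  ptime n -> ptime f -> ptime (fun x => take (n x) (f x)).
Proof.
move=> pn pf.
apply: (ptime_eq (f := fun x => rev (drop (size (f x) - n x) (rev (f x))))).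
  move=> x; rewrite drop_rev revK; case: (leqP (n x) (size (f x))) => nx.
    by rewrite subKn.
  by rewrite (eqP (ltnW nx)) subn0 take_size take_oversize // ltnW.
apply: ptime_rev; apply: ptime_drop; last exact: ptime_rev.
by apply: ptime_subn => //; apply: ptime_size.
Qed.

End Library3.

#[global] Hint Extern 1 (ptime (fun x => muln _ _)) => apply: ptime_muln : ptime.
#[global] Hint Extern 1 (ptime (fun x => drop _ _)) => apply: ptime_drop : ptime.
#[global] Hint Extern 1 (ptime (fun x => take _ _)) => apply: ptime_take : ptime.
#[global] Hint Extern 1 (ptime (fun x => nth _ _ _)) => apply: ptime_nth : ptime.
#[global] Hint Extern 1 (ptime (fun x => size _)) => apply: ptime_size : ptime.

Section Library4.
Context X (eX : encoding X).

(** Pushing the current length onto a list [n] times produces the numbers below [n] in decreasing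
    order. *)
Lemma ptime_iota0 (n : X -> nat) : ptime n -> ptime (fun x => iota 0 (n x)).
Proof.
apply: (ptime_comp (g := iota 0)).
apply: (@ptime_eq _ _ _ _ (fun n => rev (iter n (fun s => size s :: s) [::]))).
  move=> m; have sz k : size (iter k (fun s : seq nat => size s :: s) [::]) = k.
    by elim: k => //= k ->.
  by elim: m => //= m IHm; rewrite rev_cons IHm sz -cats1 -[0 :: _]/(iota 0 m.+1) -addn1 iotaD.
apply: ptime_rev.
apply: (ptime_iter (f := fun _ s => size s :: s) (g := fun=> 1)); try by ptime_auto.
by move=> x a; rewrite nrm_cons nrm_seqE /nrm /=; lia.
Qed.

Lemma ptime_map T U (eT : encoding T) (eU : encoding U) (f : X -> T -> U) (l : X -> seq T) :
  ptime (fun p : X * T => f p.1 p.2) -> ptime l -> ptime (fun x => [seq f x t | t <- l x]).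
Proof.
move=> pf pl.
apply: (@ptime_eq _ _ _ _ (fun x => rev (foldl (fun s t => f x t :: s) [::] (l x)))).
  move=> x; rewrite -[RHS]revK; congr rev; rewrite -[RHS]cats0.
  by elim: (l x) [::] => //= t s IHs r; rewrite IHs rev_cons -cats1 -catA.
have [F [d Fd] fF] := ptime_nrm pf; have [L pL lL] := ptime_nrm pl.
apply: ptime_rev; apply: (ptime_foldl (f := fun x s t => f x t :: s)) => //.
- apply: ptime_cons; last by ptime_auto.
  by apply: (ptime_comp2 pf); ptime_auto.
- exact: ptime_const.
exists (fun n => (n + L n).+2 ^ d + 1).
  by poly_bound; apply: poly_bounded_comp (poly_bounded_exp d) _; poly_bound.
move=> x a t tx; have ft : nrm (f x t) <= (nrm x + L (nrm x)).+2 ^ d.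
  apply: leq_trans (fF (x, t)) _; apply: leq_trans (Fd _) _.
  case: (d) => // k; rewrite leq_exp2r // !ltnS nrm_prodE /=.
  by have := lL x; lia.
by rewrite nrm_cons (nrm_seqE _ a); lia.
Qed.

Lemma ptime_filter T (eT : encoding T) (p : X -> T -> bool) (l : X -> seq T) :
  ptime (fun q : X * T => p q.1 q.2) -> ptime l -> ptime (fun x => [seq t <- l x | p x t]).
Proof.
move=> pp pl.
apply: (@ptime_eq _ _ _ _ (fun x => rev (foldl (fun s t => if p x t then t :: s else s) [::] (l x)))).
  move=> x; rewrite -[RHS]revK; congr rev; rewrite -[RHS]cats0.
  elim: (l x) [::] => //= t s IHs r; rewrite IHs; case: ifP => // _.
  by rewrite rev_cons -cats1 -catA.
have [L pL lL] := ptime_nrm pl.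
apply: ptime_rev; apply: (ptime_foldl (f := fun x s t => if p x t then t :: s else s)) => //.
- by ptime_auto.
- exact: ptime_const.
exists (fun n => L n + 1); first by poly_bound.
move=> x a t tx; case: ifP => _; last by rewrite leq_addr.
by move: (lL x); rewrite nrm_cons (nrm_seqE _ a); lia.
Qed.

Lemma ptime_flatten T (eT : encoding T) (l : X -> seq (seq T)) :
  ptime l -> ptime (fun x => flatten (l x)).
Proof.
move=> pl; have [L pL lL] := ptime_nrm pl.
apply: (@ptime_eq _ _ _ _ (fun x => foldl cat [::] (l x))).
  move=> x; rewrite -[RHS]cat0s; elim: (l x) [::] => [|t s IHs] r /=.
    by rewrite cats0.
  by rewrite IHs catA.
apply: (ptime_foldl (f := fun=> cat)); try by ptime_auto.
exists L => // x a t tx; apply: leq_trans (nrm_cat _ _ _) _.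
by rewrite leq_add2l; apply: leq_trans tx (lL x).
Qed.

Lemma ptime_sumn (l : X -> seq nat) : ptime l -> ptime (fun x => sumn (l x)).
Proof.
move=> pl; have [L pL lL] := ptime_nrm pl.
apply: (@ptime_eq _ _ _ _ (fun x => foldl addn 0 (l x))).
  move=> x; rewrite -[RHS]add0n; elim: (l x) 0 => [|t s IHs] m /=.
    by rewrite addn0.
  by rewrite IHs addnA.
apply: (ptime_foldl (f := fun=> addn)); try by ptime_auto.
exists L => // x a t tx; rewrite leq_add2l; exact: leq_trans tx (lL x).
Qed.

End Library4.

#[global] Hint Extern 1 (ptime (fun x => iota 0 _)) => apply: ptime_iota0 : ptime.
#[global] Hint Extern 1 (ptime (fun x => map _ _)) => apply: ptime_map : ptime.
#[global] Hint Extern 1 (ptime (fun x => filter _ _)) => apply: ptime_filter : ptime.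
#[global] Hint Extern 1 (ptime (fun x => flatten _)) => apply: ptime_flatten : ptime.
#[global] Hint Extern 1 (ptime (fun x => sumn _)) => apply: ptime_sumn : ptime.

Section Library5.
Context X (eX : encoding X).

Lemma ptime_has T (eT : encoding T) (p : X -> T -> bool) (l : X -> seq T) :
  ptime (fun q : X * T => p q.1 q.2) -> ptime l -> ptime (fun x => has (p x) (l x)).
Proof.
move=> pp pl; apply: (ptime_eq (f := fun x => ~~ nilp [seq t <- l x | p x t])).
  by move=> x; rewrite has_count -size_filter lt0n.
by ptime_auto.
Qed.

Lemma ptime_mem (v : X -> nat) (l : X -> seq nat) :
  ptime v -> ptime l -> ptime (fun x => v x \in l x).
Proof.
move=> pv pl; apply: (ptime_eq (f := fun x => has (fun u => u == v x) (l x))).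
  by move=> x; rewrite -has_pred1.
apply: (ptime_has (p := fun x u => u == v x)) => //.
by ptime_auto.
Qed.

Lemma ptime_count_mem (v : X -> nat) (l : X -> seq nat) :
  ptime v -> ptime l -> ptime (fun x => count_mem (v x) (l x)).
Proof.
move=> pv pl; apply: (ptime_eq (f := fun x => size [seq u <- l x | u == v x])).
  by move=> x; rewrite size_filter.
by ptime_auto.
Qed.

End Library5.

Lemma ptime_nat_of_bool X (eX : encoding X) (b : X -> bool) :
  ptime b -> ptime (fun x => nat_of_bool (b x)).
Proof. by move=> pb; rewrite /nat_of_bool; ptime_auto. Qed.

#[global] Hint Extern 1 (ptime (fun x => has _ _)) => apply: ptime_has : ptime.
#[global] Hint Extern 1 (ptime (fun x => in_mem _ _)) => apply: ptime_mem : ptime.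
#[global] Hint Extern 1 (ptime (fun x => count _ _)) => apply: ptime_count_mem : ptime.
#[global] Hint Extern 1 (ptime (fun x => nat_of_bool _)) => apply: ptime_nat_of_bool : ptime.
#[global] Hint Extern 1 (poly_nrm _ (fun x => addn _ _)) => apply: poly_nrm_add : ptime.
#[global] Hint Extern 1 (poly_nrm _ (fun x => muln _ _)) => apply: poly_nrm_mul : ptime.
#[global] Hint Extern 2 (poly_nrm _ _) => apply: poly_nrm_nat : ptime.
#[global] Hint Extern 2 (poly_nrm _ (fun x => nrm _)) => apply: poly_nrm_ptime : ptime.

(** * The algorithm *)

Definition edge (M : seq (seq bool)) u v := nth false (nth [::] M u) v.

Definition weight (W : seq nat) (w : seq nat) := sumn [seq nth 0 W v | v <- w].

Definition better W (a b : seq nat) :=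
  if nilp a then b else if weight W b < weight W a then b else a.

(* Entry [v] of a table is a walk to [v], in reverse, or [[::]] if none is known. *)
Definition relax_at M W (tab : seq (seq nat)) v :=
  foldl (fun b u =>
    if edge M u v && ~~ nilp (nth [::] tab u) then better W b (v :: nth [::] tab u)
    else b) (nth [::] tab v) (iota 0 (size M)).

Definition relax M W tab := [seq relax_at M W tab v | v <- iota 0 (size M)].

Definition start_table (M : seq (seq bool)) (s : nat) : seq (seq nat) :=
  [seq if v == s then [:: v] else [::] | v <- iota 0 (size M)].

(** Bellman-Ford with weights on the vertices. As many rounds as vertices suffice to beat every
    simple path; the reversal undoes the storage order of the table. *)
Definition best_walk M W s t :=
  rev (nth [::] (iter (size M) (relax M W) (start_table M s)) t).

Definition sources (prs : seq (nat * nat)) := [seq st.1 | st <- prs].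

(* Sources count twice, so that they never look attractive to other walks. *)
Definition visits prs (Q : seq (seq nat)) := sources prs ++ sources prs ++ flatten Q.

Definition visit_cost m := if m == 0 then 0 else if m == 1 then 3 else 4.

(* The factor [n.+1] exceeds the length of every path, so ties are broken by length. *)
Definition price n m := visit_cost m * n.+1 + 1.

(** The visit of path [i] itself is subtracted, since only the other paths and the sources determine
    what it pays. *)
Definition prices (M : seq (seq bool)) prs Q i :=
  [seq price (size M) (count_mem v (visits prs Q) - (v \in nth [::] Q i))
  | v <- iota 0 (size M)].

Definition upd (Q : seq (seq nat)) i w :=
  [seq if j == i then w else nth [::] Q j | j <- iota 0 (size Q)].

Definition shortest_walks (M : seq (seq bool)) (prs : seq (nat * nat)) :=
  [seq best_walk M [seq 1 | v <- iota 0 (size M)] st.1 st.2 | st <- prs].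

Definition improvement M (prs : seq (nat * nat)) Q i :=
  best_walk M (prices M prs Q i) (nth (0, 0) prs i).1 (nth (0, 0) prs i).2.

Definition improve M prs Q i :=
  if weight (prices M prs Q i) (improvement M prs Q i)
     < weight (prices M prs Q i) (nth [::] Q i)
  then upd Q i (improvement M prs Q i) else Q.

Definition improve_round M prs Q := foldl (improve M prs) Q (iota 0 (size prs)).

(** The number of rounds exceeds the potential of the initial paths, so that some round must have
    changed nothing: visits are many times cheaper to count than to price, and [price (size M) 2] is
    the highest price of one visit. *)
Definition local_search M prs :=
  iter (size (visits prs (shortest_walks M prs)) * price (size M) 2).+1
    (improve_round M prs) (shortest_walks M prs).

Definition neighbors M (w : seq nat) v :=
  [seq j <- iota 0 (size w) | edge M (nth 0 w j) v].

(** [take] up to and including position [j] and [drop] from position [j] both contain the vertex at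
    [j]: the walk steps from it to [v] and back. *)
Definition detour M Q i v :=
  if nilp (neighbors M (nth [::] Q i) v) || (v \in flatten Q) then Q
  else upd Q i (take (head 0 (neighbors M (nth [::] Q i) v)).+1 (nth [::] Q i) ++
                v :: drop (head 0 (neighbors M (nth [::] Q i) v)) (nth [::] Q i)).

Definition detours M Q i := foldl (fun Q v => detour M Q i v) Q (iota 0 (size M)).

Definition cover_round M (prs : seq (nat * nat)) Q :=
  foldl (detours M) Q (iota 0 (size prs)).

(** The number of rounds exceeds the number of uncovered vertices. *)
Definition cover_all M prs Q := iter (size M).+1 (cover_round M prs) Q.

(** Several pairs may share a source, but the pairs of an instance must be distinct; filtering the
    list of all vertices keeps each source once. *)
Definition depots (M : seq (seq bool)) prs :=
  [seq (v, v) | v <- [seq v <- iota 0 (size M) | v \in sources prs]].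

Definition depot_index (prs : seq (nat * nat)) (c : seq nat) :=
  head 0 [seq j <- iota 0 (size prs) | nth 0 (sources prs) j == head 0 c].

Definition attach prs Q c :=
  upd Q (depot_index prs c) (c ++ behead (nth [::] Q (depot_index prs c))).

Definition extend_tours M prs C := foldl (attach prs) (shortest_walks M prs) C.

Definition total_length (Q : seq (seq nat)) := sumn [seq (size w).-1 | w <- Q].

Definition solve M prs C :=
  if total_length (extend_tours M prs C) <=
     total_length (cover_all M prs (local_search M prs))
  then extend_tours M prs C else cover_all M prs (local_search M prs).

(** * Growth and running time of the algorithm *)

Arguments nrm : simpl never.

Lemma nrm_nth T (eT : encoding T) (s : seq (seq T)) i : nrm (nth [::] s i) <= nrm s.
Proof.
elim: s i => [|x s IHs] [|i] //=; first by rewrite nrm_nil.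
  by rewrite nrm_nil.
  by rewrite nrm_cons; lia.
by apply: leq_trans (IHs i) _; rewrite nrm_cons (nrm_seqE _ s); lia.
Qed.

Lemma nrm_map_iota T (eT : encoding T) (f : nat -> T) n B :
  n <= B -> (forall v, v < n -> nrm (f v) <= B) -> nrm [seq f v | v <- iota 0 n] <= B.
Proof.
move=> nB fB; rewrite nrm_seqE size_map size_iota geq_max nB big_map /=.
rewrite big_seq_cond; apply/bigmax_leqP_seq => v vn _.
by apply: fB; move: vn; rewrite mem_iota.
Qed.

Lemma nrm_upd Q i w : nrm (upd Q i w) <= maxn (nrm Q) (nrm w).
Proof.
apply: nrm_map_iota; first by apply: leq_trans (size_le_nrm _ _) (leq_maxl _ _).
move=> v _; case: ifP => _; rewrite ?leq_maxr //.
by apply: leq_trans (nrm_nth _ _ _) (leq_maxl _ _).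
Qed.

Lemma nrm_better W a b : nrm (better W a b) <= maxn (nrm a) (nrm b).
Proof. by rewrite /better; case: ifP => _; [|case: ifP => _]; rewrite ?leq_maxl ?leq_maxr. Qed.

(** A new entry is an old one with a single vertex put in front, so a round increases the norm by an
    amount independent of the table. *)
Lemma nrm_relax M W tab : nrm (relax M W tab) <= nrm tab + (size M).+1.
Proof.
apply: nrm_map_iota; first lia.
move=> v vM; rewrite /relax_at.
have : nrm (nth [::] tab v) <= nrm tab + (size M).+1.
  by apply: leq_trans (nrm_nth _ _ _) (leq_addr _ _).
elim: iota (nth [::] tab v) => //= u s IHs b bM; apply: IHs.
case: ifP => // _; apply: leq_trans (nrm_better _ _ _) _.
have := nrm_nth encoding_nat tab u; rewrite geq_max bM nrm_cons [in X in X -> _]nrm_seqE.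
have -> : nrm v = v by []; lia.
Qed.

Lemma nrm_best_walk M W s t :
  nrm (best_walk M W s t) <= (size M).+1 + size M * (size M).+1.
Proof.
rewrite nrm_rev; apply: leq_trans (nrm_nth _ _ _) _.
elim: {1 3}(size M) => [|k IHk].
  rewrite addn0; apply: nrm_map_iota => // v vM.
  by case: ifP => _; rewrite ?nrm_nil // nrm_cons big_nil /nrm /=; lia.
rewrite /=; apply: leq_trans (nrm_relax _ _ _) _; rewrite mulSn; lia.
Qed.


Lemma ptime_edge X (eX : encoding X) (M : X -> seq (seq bool)) u v :
  ptime M -> ptime u -> ptime v -> ptime (fun x => edge (M x) (u x) (v x)).
Proof. by move=> *; rewrite /edge; ptime_auto. Qed.

#[global] Hint Extern 1 (ptime (fun x => edge _ _ _)) => apply: ptime_edge : ptime.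

Lemma ptime_weight X (eX : encoding X) (W w : X -> seq nat) :
  ptime W -> ptime w -> ptime (fun x => weight (W x) (w x)).
Proof.
move=> *; rewrite /weight; apply: ptime_sumn.
by apply: (ptime_map (f := fun x v => nth 0 (W x) v)); ptime_auto.
Qed.

#[global] Hint Extern 1 (ptime (fun x => weight _ _)) => apply: ptime_weight : ptime.

Lemma ptime_better X (eX : encoding X) (W a b : X -> seq nat) :
  ptime W -> ptime a -> ptime b -> ptime (fun x => better (W x) (a x) (b x)).
Proof.
by move=> *; rewrite /better; ptime_auto.
Qed.

#[global] Hint Extern 1 (ptime (fun x => better _ _ _)) => apply: ptime_better : ptime.

Lemma ptime_relax_at X (eX : encoding X) (M : X -> seq (seq bool)) W tab v :
  ptime M -> ptime W -> ptime tab -> ptime v ->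
  ptime (fun x => relax_at (M x) (W x) (tab x) (v x)).
Proof.
move=> pM pW pt pv; rewrite /relax_at.
apply: (ptime_foldl_growth (f := fun x b u =>
    if edge (M x) u (v x) && ~~ nilp (nth [::] (tab x) u)
    then better (W x) b (v x :: nth [::] (tab x) u) else b)
  (g := fun x => nrm (tab x) + (v x).+1));
  try by ptime_auto.
move=> x a t _; case: ifP => _; last exact: leq_addr.
apply: leq_trans (nrm_better _ _ _) _; rewrite geq_max leq_addr nrm_cons.
have := nrm_nth encoding_nat (tab x) t; rewrite [in X in X -> _]nrm_seqE.
by have -> : nrm (v x) = v x by []; lia.
Qed.

#[global] Hint Extern 1 (ptime (fun x => relax_at _ _ _ _)) => apply: ptime_relax_at : ptime.

Lemma ptime_relax X (eX : encoding X) (M : X -> seq (seq bool)) W tab :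
  ptime M -> ptime W -> ptime tab -> ptime (fun x => relax (M x) (W x) (tab x)).
Proof.
move=> *; rewrite /relax.
by ptime_auto.
Qed.

#[global] Hint Extern 1 (ptime (fun x => relax _ _ _)) => apply: ptime_relax : ptime.

Lemma ptime_best_walk X (eX : encoding X) (M : X -> seq (seq bool)) W s t :
  ptime M -> ptime W -> ptime s -> ptime t ->
  ptime (fun x => best_walk (M x) (W x) (s x) (t x)).
Proof.
move=> *; rewrite /best_walk; apply: ptime_rev; apply: ptime_nth => //.
apply: (ptime_iter (f := fun x => relax (M x) (W x)) (g := fun x => (size (M x)).+1)).
- by ptime_auto.
- rewrite /start_table.
  apply: (ptime_map (f := fun x v => if v == s x then [:: v] else [::])).
    by ptime_auto.
  by ptime_auto.
- by ptime_auto.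
- by ptime_auto.
by move=> x a; apply: nrm_relax.
Qed.

#[global] Hint Extern 1 (ptime (fun x => best_walk _ _ _ _)) => apply: ptime_best_walk : ptime.

Lemma ptime_sources X (eX : encoding X) (prs : X -> seq (nat * nat)) :
  ptime prs -> ptime (fun x => sources (prs x)).
Proof.
move=> *; rewrite /sources.
by apply: (ptime_map (f := fun _ st => st.1)); ptime_auto.
Qed.

#[global] Hint Extern 1 (ptime (fun x => sources _)) => apply: ptime_sources : ptime.

Lemma ptime_visits X (eX : encoding X) (prs : X -> seq (nat * nat)) Q :
  ptime prs -> ptime Q -> ptime (fun x => visits (prs x) (Q x)).
Proof.
by move=> *; rewrite /visits; ptime_auto.
Qed.

#[global] Hint Extern 1 (ptime (fun x => visits _ _)) => apply: ptime_visits : ptime.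

Lemma ptime_price X (eX : encoding X) (n m : X -> nat) :
  ptime n -> ptime m -> ptime (fun x => price (n x) (m x)).
Proof. by move=> *; rewrite /price /visit_cost; ptime_auto. Qed.

#[global] Hint Extern 1 (ptime (fun x => price _ _)) => apply: ptime_price : ptime.

Lemma ptime_prices X (eX : encoding X) (M : X -> seq (seq bool)) prs Q i :
  ptime M -> ptime prs -> ptime Q -> ptime i ->
  ptime (fun x => prices (M x) (prs x) (Q x) (i x)).
Proof.
move=> *; rewrite /prices.
apply: (ptime_map (f := fun x v => price (size (M x))
  (count_mem v (visits (prs x) (Q x)) - (v \in nth [::] (Q x) (i x))))).
  apply: ptime_price; first by ptime_auto.
  apply: ptime_subn.
    by ptime_auto.
  by rewrite /nat_of_bool; ptime_auto.
by ptime_auto.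
Qed.

#[global] Hint Extern 1 (ptime (fun x => prices _ _ _ _)) => apply: ptime_prices : ptime.

Lemma ptime_upd X (eX : encoding X) (Q : X -> seq (seq nat)) i w :
  ptime Q -> ptime i -> ptime w -> ptime (fun x => upd (Q x) (i x) (w x)).
Proof.
move=> *; rewrite /upd.
apply: (ptime_map (f := fun x j => if j == i x then w x else nth [::] (Q x) j));
by ptime_auto.
Qed.

#[global] Hint Extern 1 (ptime (fun x => upd _ _ _)) => apply: ptime_upd : ptime.

Lemma ptime_shortest_walks X (eX : encoding X) (M : X -> seq (seq bool)) prs :
  ptime M -> ptime prs -> ptime (fun x => shortest_walks (M x) (prs x)).
Proof.
move=> *; rewrite /shortest_walks.
apply: (ptime_map (f := fun x st =>
  best_walk (M x) [seq 1 | v <- iota 0 (size (M x))] st.1 st.2)); last by [].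
by apply: ptime_best_walk; ptime_auto.
Qed.

#[global] Hint Extern 1 (ptime (fun x => shortest_walks _ _)) => apply: ptime_shortest_walks : ptime.

Lemma ptime_improvement X (eX : encoding X) (M : X -> seq (seq bool)) prs Q i :
  ptime M -> ptime prs -> ptime Q -> ptime i ->
  ptime (fun x => improvement (M x) (prs x) (Q x) (i x)).
Proof.
by move=> *; rewrite /improvement;
  ptime_auto.
Qed.

#[global] Hint Extern 1 (ptime (fun x => improvement _ _ _ _)) => apply: ptime_improvement : ptime.

Lemma ptime_improve X (eX : encoding X) (M : X -> seq (seq bool)) prs Q i :
  ptime M -> ptime prs -> ptime Q -> ptime i ->
  ptime (fun x => improve (M x) (prs x) (Q x) (i x)).
Proof.
by move=> *; rewrite /improve; ptime_auto.
Qed.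

#[global] Hint Extern 1 (ptime (fun x => improve _ _ _ _)) => apply: ptime_improve : ptime.

(** The norm of a best walk is bounded in terms of the number of vertices alone, whatever the
    weights; this makes the growth of the local search additive. *)
Definition walk_bound (M : seq (seq bool)) := (size M).+1 + size M * (size M).+1.

Lemma nrm_improve M prs Q i : nrm (improve M prs Q i) <= nrm Q + walk_bound M.
Proof.
rewrite /improve; case: ifP => _; last exact: leq_addr.
apply: leq_trans (nrm_upd _ _ _) _; rewrite geq_max leq_addr.
by apply: leq_trans (nrm_best_walk _ _ _ _) (leq_addl _ _).
Qed.

Lemma ptime_local_search X (eX : encoding X) (M : X -> seq (seq bool)) prs :
  ptime M -> ptime prs -> ptime (fun x => local_search (M x) (prs x)).
Proof.
move=> *; rewrite /local_search.
apply: (ptime_iter (f := fun x => improve_round (M x) (prs x))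
  (g := fun x => size (prs x) * walk_bound (M x))).
- rewrite /improve_round.
  apply: (ptime_foldl_growth
    (f := fun p Q i => improve (M p.1) (prs p.1) Q i) (g := fun p => walk_bound (M p.1))).
  + by ptime_auto.
  + by ptime_auto.
  + by ptime_auto.
  + by rewrite /walk_bound; ptime_auto.
  + by move=> *; apply: nrm_improve.
- by ptime_auto.
- by ptime_auto.
- by rewrite /walk_bound; ptime_auto.
move=> x Q; rewrite /improve_round; rewrite -[X in _ + X * _](size_iota 0).
by apply: (@nrm_foldl _ _ _ _ _ _ _ (nrm (iota 0 (size (prs x))))) => // *; apply: nrm_improve.
Qed.

#[global] Hint Extern 1 (ptime (fun x => local_search _ _)) => apply: ptime_local_search : ptime.

Lemma ptime_neighbors X (eX : encoding X) (M : X -> seq (seq bool)) w v :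
  ptime M -> ptime w -> ptime v -> ptime (fun x => neighbors (M x) (w x) (v x)).
Proof.
move=> *; rewrite /neighbors.
apply: (ptime_filter (p := fun x j => edge (M x) (nth 0 (w x) j) (v x)));
by ptime_auto.
Qed.

#[global] Hint Extern 1 (ptime (fun x => neighbors _ _ _)) => apply: ptime_neighbors : ptime.

Lemma ptime_detour X (eX : encoding X) (M : X -> seq (seq bool)) Q i v :
  ptime M -> ptime Q -> ptime i -> ptime v ->
  ptime (fun x => detour (M x) (Q x) (i x) (v x)).
Proof.
move=> *; rewrite /detour.
by ptime_auto.
Qed.

#[global] Hint Extern 1 (ptime (fun x => detour _ _ _ _)) => apply: ptime_detour : ptime.

Lemma nrm_detour M Q i v : nrm (detour M Q i v) <= nrm Q + v.+2.
Proof.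
rewrite /detour; case: ifP => _; first exact: leq_addr.
apply: leq_trans (nrm_upd _ _ _) _; rewrite geq_max leq_addr.
set j := head 0 _; have := nrm_nth encoding_nat Q i; move: (nth [::] Q i) => w wQ.
move: wQ; rewrite !nrm_seqE size_cat big_cat /= big_cons size_take size_drop.
have -> : nrm v = v by [].
have : \max_(y <- drop j w) nrm y <= \max_(y <- w) nrm y.
  by rewrite -{2}(cat_take_drop j w) big_cat leq_maxr.
have : \max_(y <- take j.+1 w) nrm y <= \max_(y <- w) nrm y.
  by rewrite -{2}(cat_take_drop j.+1 w) big_cat leq_maxl.
by case: ifP; lia.
Qed.

(** Inside a fold a vertex is only known to have norm at most that of the list [iota 0 (size M)], so
    the growth is stated through that norm. *)
Definition detour_growth (M : seq (seq bool)) := (nrm (iota 0 (size M))).+2.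

Lemma ptime_cover_all X (eX : encoding X) (M : X -> seq (seq bool)) prs Q :
  ptime M -> ptime prs -> ptime Q -> ptime (fun x => cover_all (M x) (prs x) (Q x)).
Proof.
move=> *; rewrite /cover_all.
have gP (M' : seq (seq bool)) Q' i v : nrm v <= nrm (iota 0 (size M')) ->
    nrm (detour M' Q' i v) <= nrm Q' + detour_growth M'.
  by move=> vM; apply: leq_trans (nrm_detour _ _ _ _) _; rewrite leq_add2l /detour_growth !ltnS.
have gP' (M' : seq (seq bool)) Q' i : nrm (detours M' Q' i) <= nrm Q' + size M' * detour_growth M'.
  rewrite /detours -[X in _ + X * _](size_iota 0).
  by apply: (@nrm_foldl _ _ _ _ _ _ _ (nrm (iota 0 (size M')))) => // *; apply: gP.
have pg Y (eY : encoding Y) (M' : Y -> seq (seq bool)) : ptime M' ->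
    poly_nrm eY (fun x => detour_growth (M' x)).
  move=> pM; rewrite /detour_growth; have := poly_nrm_add (poly_nrm_const _ 2) (poly_nrm_ptime (f := fun x => iota 0 (size (M' x))) _).
  by apply; ptime_auto.
apply: (ptime_iter (f := fun x => cover_round (M x) (prs x))
  (g := fun x => size (prs x) * (size (M x) * detour_growth (M x)))).
- rewrite /cover_round.
  apply: (ptime_foldl_growth (f := fun p => detours (M p.1))
    (g := fun p => size (M p.1) * detour_growth (M p.1))).
  + rewrite /detours.
    apply: (ptime_foldl_growth (f := fun p Q v => detour (M p.1.1.1) Q p.2 v)
      (g := fun p => detour_growth (M p.1.1.1))).
    * by ptime_auto.
    * by ptime_auto.
    * by ptime_auto.
    * by apply: pg; ptime_auto.
    * by move=> *; apply: gP.
  + by ptime_auto.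
  + by ptime_auto.
  + by ptime_auto.
  + by move=> *; apply: gP'.
- by ptime_auto.
- by ptime_auto.
- by ptime_auto.
move=> x Q'; rewrite /cover_round -[X in _ + X * _](size_iota 0).
by apply: (@nrm_foldl _ _ _ _ _ _ _ (nrm (iota 0 (size (prs x))))) => // *; apply: gP'.
Qed.

#[global] Hint Extern 1 (ptime (fun x => cover_all _ _ _)) => apply: ptime_cover_all : ptime.

Lemma nrm_behead T (eT : encoding T) (s : seq T) : nrm (behead s) <= nrm s.
Proof. by rewrite !nrm_seqE; case: s => //= t s; rewrite big_cons; lia. Qed.

Lemma ptime_extend_tours X (eX : encoding X) (M : X -> seq (seq bool)) prs C :
  ptime M -> ptime prs -> ptime C ->
  ptime (fun x => extend_tours (M x) (prs x) (C x)).
Proof.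
move=> *; rewrite /extend_tours.
apply: (ptime_foldl_growth (f := fun x Q c => attach (prs x) Q c)
  (g := fun x => nrm (C x))).
- rewrite /attach /depot_index.
  have pi Y (eY : encoding Y) (p : Y -> seq (nat * nat)) c : ptime p -> ptime c ->
      ptime (fun x => head 0 [seq j <- iota 0 (size (p x)) | nth 0 (sources (p x)) j == head 0 (c x)]).
    move=> *; apply: ptime_head.
    apply: (ptime_filter (p := fun x j => nth 0 (sources (p x)) j == head 0 (c x)));
    by ptime_auto.
  by ptime_auto.
- by ptime_auto.
- by ptime_auto.
- by ptime_auto.
move=> x Q c cC; apply: leq_trans (nrm_upd _ _ _) _; rewrite geq_max leq_addr /=.
apply: leq_trans (nrm_cat _ _ _) _; rewrite addnC leq_add //.
exact: leq_trans (nrm_behead _ _) (nrm_nth _ _ _).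
Qed.

#[global] Hint Extern 1 (ptime (fun x => extend_tours _ _ _)) => apply: ptime_extend_tours : ptime.

Lemma ptime_total_length X (eX : encoding X) (Q : X -> seq (seq nat)) :
  ptime Q -> ptime (fun x => total_length (Q x)).
Proof.
move=> *; rewrite /total_length; apply: ptime_sumn.
by apply: (ptime_map (f := fun _ w => (size w).-1)); ptime_auto.
Qed.

#[global] Hint Extern 1 (ptime (fun x => total_length _)) => apply: ptime_total_length : ptime.

Lemma ptime_solve X (eX : encoding X) (M : X -> seq (seq bool)) prs C :
  ptime M -> ptime prs -> ptime C -> ptime (fun x => solve (M x) (prs x) (C x)).
Proof.
by move=> *; rewrite /solve; ptime_auto.
Qed.

Lemma ptime_depots X (eX : encoding X) (M : X -> seq (seq bool)) prs :
  ptime M -> ptime prs -> ptime (fun x => depots (M x) (prs x)).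
Proof.
move=> *; rewrite /depots.
apply: (ptime_map (f := fun _ v => (v, v))); first by ptime_auto.
apply: (ptime_filter (p := fun x v => v \in sources (prs x)));
by ptime_auto.
Qed.

#[global] Hint Extern 1 (ptime (fun x => depots _ _)) => apply: ptime_depots : ptime.

(** * Correctness *)

Section Fixpoints.
Variables (S : Type) (inv : S -> Prop) (phi : S -> nat).

Lemma foldl_decreasing (I : eqType) (f : S -> I -> S) (l : seq I) :
  (forall i x, i \in l -> inv x -> inv (f x i) /\ (f x i = x \/ phi (f x i) < phi x)) ->
  forall x, inv x -> inv (foldl f x l) /\
    (foldl f x l = x \/ phi (foldl f x l) < phi x).
Proof.
elim: l => [|i l IHl] fP x ix /=; first by split; [|left].
have [ifx fx] := fP i x (mem_head _ _) ix.
have fP' j y : j \in l -> inv y -> inv (f y j) /\ (f y j = y \/ phi (f y j) < phi y).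
  by move=> jl; apply: fP; rewrite inE jl orbT.
have [ify fy] := IHl fP' _ ifx; split=> //.
case: fx => [fx|fx]; first by rewrite fx in fy *.
by right; case: fy => [->//|fy]; apply: ltn_trans fy fx.
Qed.

(** A step that changed the state would lower [phi], and later steps never raise it again, so the
    pass could not return to its start. *)
Lemma foldl_fixed (I : eqType) (f : S -> I -> S) (l : seq I) :
  (forall i x, i \in l -> inv x -> inv (f x i) /\ (f x i = x \/ phi (f x i) < phi x)) ->
  forall x, inv x -> foldl f x l = x -> forall i, i \in l -> f x i = x.
Proof.
elim: l => // j l IHl fP x ix /= fx i.
have fP' i' y : i' \in l -> inv y -> inv (f y i') /\ (f y i' = y \/ phi (f y i') < phi y).
  by move=> il; apply: fP; rewrite inE il orbT.
have [ij fj] := fP j x (mem_head _ _) ix; have [_ fl] := foldl_decreasing fP' ij.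
have {}fj : f x j = x.
  by case: fj => // fj; case: fl => [|]; rewrite fx => fl; [rewrite -fl | lia].
rewrite fj in fx; rewrite inE => /predU1P[->//|]; exact: IHl.
Qed.

(** A round either changes nothing, and then all further rounds agree with it, or lowers [phi],
    which can happen fewer than [N] times. *)
Lemma iter_decreasing (g : S -> S) (N : nat) (x : S) :
  (forall x, inv x -> inv (g x) /\ (g x = x \/ phi (g x) < phi x)) ->
  inv x -> phi x < N -> inv (iter N g x) /\ g (iter N g x) = iter N g x.
Proof.
move=> gP; elim: N x => // N IHN x ix xN; rewrite !iterSr.
have [igx [gx|gx]] := gP x ix; last by apply: IHN => //; apply: leq_trans gx xN.
rewrite gx; have -> : iter N g x = x by elim: (N) => //= k ->.
by rewrite gx.
Qed.
End Fixpoints.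

Lemma leq_sum_uniq_subset (T : eqType) (F : T -> nat) (a b : seq T) :
  uniq a -> {subset a <= b} -> \sum_(x <- a) F x <= \sum_(x <- b) F x.
Proof.
elim: a b => [|x a IHa] b /=; first by rewrite big_nil.
move=> /andP[xa ua] ab; have xb : x \in b by apply: ab; rewrite mem_head.
rewrite (perm_big _ (perm_to_rem xb)) !big_cons leq_add2l; apply: IHa => // y ya.
have : y \in b by apply: ab; rewrite inE ya orbT.
rewrite (perm_mem (perm_to_rem xb)) inE => /predU1P[yx|//].
by rewrite -yx ya in xa.
Qed.

(** Each element of [b] left over by [a] contributes at least 1 to the sum. This detects repeated
    vertices in a walk of least weight. *)
Lemma leq_sum_uniq_subset_size (T : eqType) (F : T -> nat) (a b : seq T) :
  (forall x, x \in b -> 0 < F x) -> uniq a -> {subset a <= b} ->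
  \sum_(x <- a) F x + size b <= \sum_(x <- b) F x + size a.
Proof.
elim: a b => [|x a IHa] b F0 /=.
  rewrite big_nil addn0 => _ _; rewrite -sum1_size.
  by rewrite !(big_seq_cond predT) leq_sum // => y /andP[/F0].
move=> /andP[xa ua] ab; have xb : x \in b by apply: ab; rewrite mem_head.
rewrite (perm_big _ (perm_to_rem xb)) (perm_size (perm_to_rem xb)) !big_cons /=.
have sub : {subset a <= rem x b}.
  move=> y ya; have : y \in b by apply: ab; rewrite inE ya orbT.
  rewrite (perm_mem (perm_to_rem xb)) inE => /predU1P[yx|//].
  by rewrite -yx ya in xa.
have := IHa (rem x b) (fun y yb => F0 y (mem_rem yb)) ua sub; lia.
Qed.

Lemma sum_uniq_iota n (F : nat -> nat) (a : seq nat) :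
  uniq a -> (forall x, x \in a -> x < n) ->
  \sum_(x <- a) F x = \sum_(v <- iota 0 n) (v \in a) * F v.
Proof.
move=> ua an; have pa : perm_eq a [seq v <- iota 0 n | v \in a].
  apply: uniq_perm => //; first by rewrite filter_uniq ?iota_uniq.
  move=> v; rewrite mem_filter mem_iota /= add0n.
  by case va: (v \in a) => //=; rewrite (an v va).
rewrite (perm_big _ pa) big_filter big_mkcond.
by apply: eq_bigr => v _; case: ifP; rewrite ?mul1n ?mul0n.
Qed.

(** * Walks in an adjacency matrix and walks of least weight *)

Section Walks.
Variable M : seq (seq bool).
Notation n := (size M).
Notation e := (edge M).

Definition is_walk_nat s t (w : seq nat) :=
  if w is x :: p then [&& x == s, path e x p & last x p == t] else false.

Hypothesis edge_lt : forall u v, e u v -> (u < n) && (v < n).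

Lemma is_walk_nat_lt s t w : s < n -> is_walk_nat s t w -> forall v, v \in w -> v < n.
Proof.
case: w => //= x p sn /and3P[/eqP-> pp _] v; rewrite inE => /predU1P[->//|].
elim: p s {sn} pp => //= y p IHp s /andP[/edge_lt/andP[_ yn] pp].
by rewrite inE => /predU1P[->//|]; apply: IHp pp.
Qed.

Lemma is_walk_nat_rcons s u v w :
  is_walk_nat s u w -> e u v -> is_walk_nat s v (rcons w v).
Proof.
case: w => //= x p /and3P[-> pp /eqP lp] euv.
by rewrite rcons_path pp lp euv last_rcons eqxx.
Qed.

Lemma is_walk_nat_head s t w : is_walk_nat s t w -> w = s :: behead w.
Proof. by case: w => //= x p /and3P[/eqP->]. Qed.

Lemma is_walk_nat_cat s u t w1 w2 : is_walk_nat s u w1 -> is_walk_nat u t w2 ->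
  is_walk_nat s t (w1 ++ behead w2).
Proof.
case: w1 => //= x p /and3P[-> pp /eqP lp]; case: w2 => //= y q /and3P[/eqP-> pq lq].
by rewrite cat_path pp lp pq last_cat lp lq.
Qed.

Lemma is_walk_nat_size s t w : is_walk_nat s t w -> 0 < size w.
Proof. by case: w. Qed.

Lemma is_walk_nat_source s t w : is_walk_nat s t w -> s \in w.
Proof. by move/is_walk_nat_head->; rewrite mem_head. Qed.

Lemma is_walk_nat_shorten s t w : is_walk_nat s t w ->
  exists w', [/\ is_walk_nat s t w', uniq w' & {subset w' <= w}].
Proof.
case: w => //= x p /and3P[/eqP-> pp /eqP <-].
case: (shortenP pp) => p' pp' up' sub; exists (s :: p'); split => //=.
  by rewrite pp' !eqxx.
by move=> v; rewrite !inE => /predU1P[->|/sub->]; rewrite ?eqxx ?orbT.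
Qed.

Lemma uniq_walk_size s t w : s < n -> is_walk_nat s t w -> uniq w -> size w <= n.
Proof.
move=> sn ws uw; rewrite -[n](size_iota 0); apply: uniq_leq_size => // v /(is_walk_nat_lt sn ws).
by rewrite mem_iota.
Qed.

Section BestWalk.
Variable W : seq nat.

Lemma weight_sum w : weight W w = \sum_(v <- w) nth 0 W v.
Proof. by rewrite /weight sumnE big_map. Qed.

Lemma weight_rev w : weight W (rev w) = weight W w.
Proof. by rewrite !weight_sum big_rev. Qed.

Lemma weight_cons v w : weight W (v :: w) = nth 0 W v + weight W w.
Proof. by []. Qed.

(* An empty list stands for the absence of a walk, of infinite weight. *)
Definition beats (a b : seq nat) := nilp b || (~~ nilp a && (weight W a <= weight W b)).

Lemma beats_refl a : beats a a.
Proof. by rewrite /beats leqnn andbT orbN. Qed.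

Lemma beats_trans a b c : beats a b -> beats b c -> beats a c.
Proof.
rewrite /beats; case: (nilp c) => //= /orP[->//|/andP[-> ab]] /andP[_ bc].
exact: leq_trans ab bc.
Qed.

Lemma better_beats_l a b : ~~ nilp b -> beats (better W a b) a.
Proof.
move=> b0; rewrite /beats /better; case: ifP => //= a0.
by case: ifP => [/ltnW ->|]; rewrite ?b0 ?a0 ?leqnn.
Qed.

Lemma better_beats_r a b : ~~ nilp b -> beats (better W a b) b.
Proof.
move=> b0; rewrite /beats /better (negbTE b0) /=; case: ifP => //= a0.
  by rewrite b0 leqnn.
by case: ifP => ab; rewrite ?b0 ?leqnn // a0 /= leqNgt ab.
Qed.

Lemma relax_at_beats tab v :
  beats (relax_at M W tab v) (nth [::] tab v) /\
  forall u, u < n -> e u v -> ~~ nilp (nth [::] tab u) ->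
    beats (relax_at M W tab v) (v :: nth [::] tab u).
Proof.
rewrite /relax_at; set f := fun _ _ => _.
have fP b u : beats (f b u) b.
  by rewrite /f; case: ifP => [/andP[_ c0]|_]; [apply: better_beats_l|apply: beats_refl].
have foldP b l : beats (foldl f b l) b.
  elim: l b => [|u l IHl] b /=; first exact: beats_refl.
  exact: beats_trans (IHl _) (fP b u).
split; first exact: foldP.
move=> u un euv c0; have : u \in iota 0 n by rewrite mem_iota.
elim: (iota 0 n) (nth [::] tab v) => // x l IHl b; rewrite inE => /predU1P[<-|ul] /=.
  by apply: beats_trans (foldP _ _) _; rewrite /f euv c0 /=; apply: better_beats_r.
exact: IHl.
Qed.

Definition table_ok s tab :=
  forall v, v < n -> nilp (nth [::] tab v) || is_walk_nat s v (rev (nth [::] tab v)).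

Lemma relax_at_ok s tab v : table_ok s tab -> v < n ->
  nilp (relax_at M W tab v) || is_walk_nat s v (rev (relax_at M W tab v)).
Proof.
move=> tabP vn; rewrite /relax_at; move: (tabP v vn).
elim: iota (nth _ tab v) => //= u l IHl b bP; apply: IHl.
case: ifP => // /andP[euv c0]; have /andP[un _] := edge_lt euv.
have := tabP u un; rewrite (negbTE c0) /= => wu.
rewrite /better; case: ifP => _; [|case: ifP => // _];
  by rewrite /= rev_cons (is_walk_nat_rcons wu euv).
Qed.

Lemma nth_relax tab v : v < n -> nth [::] (relax M W tab) v = relax_at M W tab v.
Proof. by move=> vn; rewrite (nth_map 0) ?size_iota // nth_iota. Qed.

Lemma nth_start_table s v : v < n ->
  nth [::] (start_table M s) v = if v == s then [:: v] else [::].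
Proof. by move=> vn; rewrite (nth_map 0) ?size_iota // nth_iota. Qed.

Lemma iter_relax_ok s r : s < n -> table_ok s (iter r (relax M W) (start_table M s)).
Proof.
move=> sn; elim: r => [|r IHr] v vn /=; last by rewrite nth_relax // relax_at_ok.
by rewrite nth_start_table //; case: eqP => //= ->; rewrite eqxx.
Qed.

(** Induction on the rounds: the walk without its last vertex is already beaten by the entry of its
    endpoint, and relaxation extends that entry by the last vertex. *)
Lemma iter_relax_beats s r v w : s < n -> is_walk_nat s v w -> size w <= r.+1 ->
  beats (nth [::] (iter r (relax M W) (start_table M s)) v) (rev w).
Proof.
move=> sn; elim: r v w => [|r IHr] v w ww wr.
  case: w ww wr => [|x [|y p]] //= /andP[/eqP-> /eqP <-] _.
  by rewrite nth_start_table // eqxx beats_refl.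
have vn : v < n by apply: (is_walk_nat_lt sn ww); case: (w) ww => //= x p /and3P[_ _ /eqP<-]; rewrite mem_last.
rewrite /= nth_relax //; set tab := iter _ _ _.
have [b1 b2] := relax_at_beats tab v.
case/lastP: w ww wr => // w x; case: w => [|y p] ww wr.
  by apply: beats_trans b1 _; apply: IHr.
have : is_walk_nat s v (rcons (y :: p) x) by [].
rewrite /= rcons_path last_rcons => /and3P[ys /andP[pp exy] /eqP xv].
rewrite xv in exy wr *.
have wu : is_walk_nat s (last y p) (y :: p) by rewrite /= ys pp eqxx.
have bu : beats (nth [::] tab (last y p)) (rev (y :: p)).
  by apply: IHr => //; move: wr; rewrite size_rcons.
have ln : last y p < n by apply: (is_walk_nat_lt sn wu); rewrite mem_last.
have [c0 cw] : ~~ nilp (nth [::] tab (last y p)) /\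
    weight W (nth [::] tab (last y p)) <= weight W (rev (y :: p)).
  by move: bu; rewrite /beats /nilp size_rev /= => /andP.
rewrite (rev_rcons (y :: p) v); apply: beats_trans (b2 _ ln exy c0) _.
by rewrite /beats /= !weight_cons leq_add2l.
Qed.

Lemma weight_shorten s t w : s < n -> is_walk_nat s t w ->
  exists w', [/\ is_walk_nat s t w', uniq w', {subset w' <= w} & weight W w' <= weight W w].
Proof.
move=> sn /is_walk_nat_shorten[w' [w'P uw' sub]]; exists w'; split => //.
by rewrite !weight_sum leq_sum_uniq_subset.
Qed.

Hypothesis connected : forall u v, u < n -> v < n -> exists w, is_walk_nat u v w.

(** Shortening a walk to a simple one never raises its weight, and a simple walk has at most
    [size M] vertices, so the final table entry beats it. *)
Lemma best_walkP s t : s < n -> t < n ->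
  is_walk_nat s t (best_walk M W s t) /\
  forall w, is_walk_nat s t w -> weight W (best_walk M W s t) <= weight W w.
Proof.
move=> sn tn; rewrite /best_walk; set b := nth _ _ _.
have bw w : is_walk_nat s t w -> ~~ nilp b /\ weight W b <= weight W w.
  move=> /(weight_shorten sn)[w' [ww' uw' _ w'w]].
  have sw' : size w' <= n.+1 by apply: leq_trans (uniq_walk_size sn ww' uw') _.
  have := iter_relax_beats sn ww' sw'.
  rewrite /beats /nilp size_rev weight_rev; case: w' {uw' sw'} ww' w'w => //= x p _ w'w.
  by move=> /andP[-> bw']; split=> //; apply: leq_trans bw' w'w.
have [w0 w0P] := connected sn tn; have [b0 _] := bw w0 w0P.
split; last by move=> w /bw[_]; rewrite weight_rev.
by have := iter_relax_ok n sn tn; rewrite -/b (negbTE b0).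
Qed.

(** If a vertex were repeated, the simple shortening would drop an occurrence of positive weight and
    be lighter. *)
Lemma best_walk_uniq s t : (forall v, v < n -> 0 < nth 0 W v) ->
  s < n -> t < n -> uniq (best_walk M W s t).
Proof.
move=> W0 sn tn; have [bP bmin] := best_walkP sn tn.
have [w' [ww' uw' sub]] := is_walk_nat_shorten bP.
have wle := bmin w' ww'.
have pos x : x \in best_walk M W s t -> 0 < nth 0 W x.
  by move=> xb; apply/W0/(is_walk_nat_lt sn bP).
have := leq_sum_uniq_subset_size pos uw' sub; rewrite -!weight_sum => le.
by apply: leq_size_uniq uw' sub _; lia.
Qed.
End BestWalk.
End Walks.

Lemma sum_uniq_ord n (F : nat -> nat) (a : seq nat) :
  uniq a -> (forall x, x \in a -> x < n) ->
  \sum_(x <- a) F x = \sum_(v < n) ((v : nat) \in a) * F v.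
Proof.
move=> ua an; rewrite (sum_uniq_iota F ua an).
by rewrite -(big_mkord xpredT (fun v => (v \in a) * F v)) /index_iota subn0.
Qed.

Lemma sum_count_mem n (s : seq nat) :
  \sum_(v < n) count_mem (v : nat) s = count (fun x => x < n) s.
Proof.
elim: s => [|x s IHs] /=; first by rewrite big1.
rewrite big_split /= IHs; congr (_ + _).
case: (ltnP x n) => [xn|nx]; last first.
  by rewrite big1 // => v _; apply/eqP; rewrite eqb0; apply/eqP; have := ltn_ord v; lia.
rewrite (bigD1 (Ordinal xn)) //= eqxx big1 ?addn0 // => v vx.
by apply/eqP; rewrite eqb0 eq_sym; apply: contraNneq vx => vx; apply/eqP/val_inj.
Qed.

Lemma size_upd Q i w : size (upd Q i w) = size Q.
Proof. by rewrite size_map size_iota. Qed.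

Lemma nth_upd Q i w j : j < size Q ->
  nth [::] (upd Q i w) j = if j == i then w else nth [::] Q j.
Proof. by move=> jQ; rewrite (nth_map 0) ?size_iota // nth_iota. Qed.

(** Old and new term stand on opposite sides to avoid truncated subtraction. *)
Lemma sum_upd k (F : seq nat -> nat) Q i w : size Q = k -> i < k ->
  \sum_(j < k) F (nth [::] (upd Q i w) j) + F (nth [::] Q i) =
  \sum_(j < k) F (nth [::] Q j) + F w.
Proof.
move=> Qk ik; rewrite (bigD1 (Ordinal ik)) //= [in RHS](bigD1 (Ordinal ik)) //=.
rewrite nth_upd ?Qk // eqxx.
under eq_bigr => j ji.
  rewrite nth_upd ?Qk // ifN; first over.
  by apply: contraNneq ji => ji; apply/eqP/val_inj.
lia.
Qed.

Lemma flatten_nthP (Q : seq (seq nat)) v :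
  reflect (exists2 i, i < size Q & v \in nth [::] Q i) (v \in flatten Q).
Proof.
apply: (iffP flattenP) => [[w wQ vw]|[i iQ vi]].
  by exists (index w Q); rewrite ?index_mem ?nth_index.
by exists (nth [::] Q i) => //; apply: mem_nth.
Qed.

Lemma sum_nth T (x0 : T) (F : T -> nat) (s : seq T) :
  \sum_(x <- s) F x = \sum_(i < size s) F (nth x0 s i).
Proof. by rewrite (big_nth x0) big_mkord. Qed.

Lemma count_flatten_nth (Q : seq (seq nat)) v :
  count_mem v (flatten Q) = \sum_(i < size Q) count_mem v (nth [::] Q i).
Proof. by rewrite count_flatten sumnE big_map (sum_nth [::]). Qed.

Lemma total_lengthE Q : total_length Q = \sum_(i < size Q) (size (nth [::] Q i)).-1.
Proof. by rewrite /total_length sumnE big_map (sum_nth [::]). Qed.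

(** * Families of paths and the potential of the local search *)

Section MultiPath.
Variables (M : seq (seq bool)) (prs : seq (nat * nat)).
Notation n := (size M).
Notation k := (size prs).
Notation e := (edge M).
Notation src i := (nth (0, 0) prs i).1.
Notation tgt i := (nth (0, 0) prs i).2.

Hypothesis edge_lt : forall u v, e u v -> (u < n) && (v < n).
Hypothesis connected : forall u v, u < n -> v < n -> exists w, is_walk_nat M u v w.
Hypothesis pairs_lt : forall i, i < k -> src i < n /\ tgt i < n.

Definition walks_ok Q :=
  size Q = k /\ forall i, i < k -> is_walk_nat M (src i) (tgt i) (nth [::] Q i).

Definition paths_ok Q := walks_ok Q /\ forall i, i < k -> uniq (nth [::] Q i).

Lemma walks_ok_upd Q i w : walks_ok Q -> is_walk_nat M (src i) (tgt i) w ->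
  walks_ok (upd Q i w).
Proof.
move=> [Qk QP] wP; split; first by rewrite size_upd.
by move=> j jk; rewrite nth_upd ?Qk //; case: eqP => [->|_]; last exact: QP.
Qed.

Lemma paths_ok_upd Q i w : paths_ok Q -> is_walk_nat M (src i) (tgt i) w -> uniq w ->
  paths_ok (upd Q i w).
Proof.
move=> [QP uQ] wP uw; split; first exact: walks_ok_upd.
by move=> j jk; rewrite nth_upd ?(proj1 QP) //; case: eqP => // _; apply: uQ.
Qed.

Lemma walks_ok_lt Q i v : walks_ok Q -> i < k -> v \in nth [::] Q i -> v < n.
Proof.
move=> [_ QP] ik; apply: (is_walk_nat_lt edge_lt _ (QP i ik)).
by case: (pairs_lt ik).
Qed.

Definition load (Q : seq (seq nat)) (v : nat) := count_mem v (visits prs Q).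
Definition source_load (v : nat) := \sum_(i < k) (src i == v).
Definition path_load (Q : seq (seq nat)) (v : nat) := \sum_(i < k) (v \in nth [::] Q i).

Lemma count_sources v : count_mem v (sources prs) = source_load v.
Proof.
rewrite /source_load -sum1_count big_map big_mkcond (sum_nth (0, 0)).
by apply: eq_bigr => i _ /=; case: eqP.
Qed.

Lemma loadE Q v : paths_ok Q -> load Q v = 2 * source_load v + path_load Q v.
Proof.
move=> [[Qk _] uQ]; rewrite /load /visits !count_cat count_sources count_flatten_nth Qk.
rewrite addnA addnn mul2n; congr (_ + _).
by apply: eq_bigr => i _; rewrite count_uniq_mem // uQ.
Qed.

Lemma path_load_ge Q v i : i < k -> (v \in nth [::] Q i) <= path_load Q v.
Proof. by move=> ik; rewrite /path_load (bigD1 (Ordinal ik)) //= leq_addr. Qed.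

Lemma nth_prices Q i v : v < n ->
  nth 0 (prices M prs Q i) v = price n (load Q v - (v \in nth [::] Q i)).
Proof. by move=> vn; rewrite (nth_map 0) ?size_iota // nth_iota. Qed.

Lemma price_gt0 m : 0 < price n m.
Proof. by rewrite /price addn1. Qed.

Lemma prices_gt0 Q i v : v < n -> 0 < nth 0 (prices M prs Q i) v.
Proof. by move=> vn; rewrite nth_prices // price_gt0. Qed.

Definition total_price m := \sum_(j < m) price n j.
(** The Rosenthal potential: the visits of a vertex are priced one after the other, the next one
    seeing [j] earlier visits. *)
Definition potential Q := \sum_(v < n) total_price (load Q v).

Lemma weight_prices Q i w : uniq w -> (forall v, v \in w -> v < n) ->
  weight (prices M prs Q i) w =
  \sum_(v < n) ((v : nat) \in w) * price n (load Q v - ((v : nat) \in nth [::] Q i)).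
Proof.
move=> uw wn; rewrite weight_sum (sum_uniq_ord _ uw wn).
by apply: eq_bigr => v _; rewrite nth_prices.
Qed.

(** At a vertex left by path [i] the sum of prices loses its last term, and at one newly entered it
    gains the next term. These are the prices that path [i] sees, since its own visit is not
    counted. *)
Lemma potential_upd Q i w : paths_ok Q -> i < k ->
  is_walk_nat M (src i) (tgt i) w -> uniq w ->
  potential (upd Q i w) + weight (prices M prs Q i) (nth [::] Q i) =
  potential Q + weight (prices M prs Q i) w.
Proof.
move=> QP ik wP uw; have [[Qk Qw] uQ] := QP.
have wn v : v \in w -> v < n.
  by apply: (is_walk_nat_lt edge_lt _ wP); case: (pairs_lt ik).
rewrite !weight_prices ?uQ //; last by move=> v; apply: walks_ok_lt (proj1 QP) ik.
rewrite /potential -!big_split /=; apply: eq_bigr => v _.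
have := sum_upd (fun u => ((v : nat) \in u) : nat) w Qk ik.
rewrite -/(path_load (upd Q i w) v) -/(path_load Q v).
rewrite (loadE v (paths_ok_upd QP wP uw)) (loadE v QP).
have := path_load_ge Q v ik.
have tp m : total_price m.+1 = total_price m + price n m by rewrite /total_price big_ord_recr.
set a := path_load Q v; set b := path_load (upd Q i w) v; set s := 2 * _.
case: (_ \in nth _ _ _); case: (_ \in w) => /= a0 ab; rewrite ?mul1n ?mul0n ?addn0 ?subn0.
- by have -> : b = a by lia.
- have -> : s + a = (s + b).+1 by lia.
  by rewrite tp subn1.
- by have -> : s + b = (s + a).+1 by lia.
- by have -> : b = a by lia.
Qed.

Lemma improve_decreasing i Q : i < k -> paths_ok Q ->
  paths_ok (improve M prs Q i) /\
  (improve M prs Q i = Q \/ potential (improve M prs Q i) < potential Q).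
Proof.
move=> ik QP; rewrite /improve; case: ifP => lt; last by split; [|left].
have [sn tn] := pairs_lt ik.
have [wP _] := best_walkP edge_lt (prices M prs Q i) connected sn tn.
have uw := best_walk_uniq edge_lt connected (@prices_gt0 Q i) sn tn.
split; first exact: paths_ok_upd.
by right; have := potential_upd QP ik wP uw; rewrite /improvement in lt *; lia.
Qed.

Lemma shortest_walks_ok : paths_ok (shortest_walks M prs).
Proof.
have one v : v < n -> 0 < nth 0 [seq 1 | v <- iota 0 n] v.
  by move=> vn; rewrite (nth_map 0) ?size_iota.
split; [split=> [|i ik]|move=> i ik]; rewrite ?size_map // (nth_map (0, 0)) //;
  have [sn tn] := pairs_lt ik.
  by have [] := best_walkP edge_lt [seq 1 | v <- iota 0 n] connected sn tn.
exact: best_walk_uniq.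
Qed.

Lemma shortest_walks_min Q : walks_ok Q ->
  total_length (shortest_walks M prs) <= total_length Q.
Proof.
move=> [Qk QP]; rewrite !total_lengthE size_map Qk; apply: leq_sum => i _.
have ik := ltn_ord i; have [sn tn] := pairs_lt ik.
have wt w : is_walk_nat M (src i) (tgt i) w -> weight [seq 1 | v <- iota 0 n] w = size w.
  move=> wP; rewrite weight_sum -(sum1_size w) big_seq [RHS]big_seq; apply: eq_bigr => v vw.
  by rewrite (nth_map 0) // size_iota (is_walk_nat_lt edge_lt sn wP).
have [bP bmin] := best_walkP edge_lt [seq 1 | v <- iota 0 n] connected sn tn.
rewrite (nth_map (0, 0)) //; have := bmin _ (QP i ik); rewrite !wt //; last exact: QP.
by rewrite -!subn1; apply: leq_sub2r.
Qed.

Lemma visit_cost_le m m' : m <= m' -> visit_cost m <= visit_cost m'.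
Proof. by case: m m' => [|[|m]] [|[|m']]. Qed.

(** No visit is priced higher than [price n 2], as [visit_cost] is constant from 2 on. *)
Lemma potential_lt Q : potential Q < (size (visits prs Q) * price n 2).+1.
Proof.
rewrite ltnS; apply: (@leq_trans (\sum_(v < n) load Q v * price n 2)).
  apply: leq_sum => v _; rewrite /total_price -[load Q v in leqRHS]card_ord -sum_nat_const.
  apply: leq_sum => j _; rewrite /price leq_add2r leq_mul2r; apply/orP; right.
  by case: (j : nat) => [|[|]].
by rewrite -big_distrl /= leq_mul2r sum_count_mem count_size orbT.
Qed.

(** * Local optima compared with an arbitrary solution *)

Definition locally_optimal Q := forall i w, i < k ->
  is_walk_nat M (src i) (tgt i) w ->
  weight (prices M prs Q i) (nth [::] Q i) <= weight (prices M prs Q i) w.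

Lemma local_searchP :
  paths_ok (local_search M prs) /\ locally_optimal (local_search M prs).
Proof.
have stepP i Q : i \in iota 0 k -> paths_ok Q -> paths_ok (improve M prs Q i) /\
    (improve M prs Q i = Q \/ potential (improve M prs Q i) < potential Q).
  by rewrite mem_iota; apply: improve_decreasing.
have roundP Q : paths_ok Q -> paths_ok (improve_round M prs Q) /\
    (improve_round M prs Q = Q \/ potential (improve_round M prs Q) < potential Q).
  exact: foldl_decreasing.
have [QP Qfix] := iter_decreasing roundP shortest_walks_ok (potential_lt _).
rewrite -/(local_search M prs) in QP Qfix; split=> // i w ik wP.
set Q := local_search M prs in QP Qfix *.
have ii : i \in iota 0 k by rewrite mem_iota.
have := foldl_fixed stepP QP Qfix ii.
rewrite /improve; have [sn tn] := pairs_lt ik.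
have [bP bmin] := best_walkP edge_lt (prices M prs Q i) connected sn tn.
have ub := best_walk_uniq edge_lt connected (@prices_gt0 Q i) sn tn.
case: ifP => [lt same|/negbT]; last first.
  by rewrite -leqNgt => le _; apply: leq_trans le (bmin w wP).
(* A replacement that is strictly cheaper yet leaves the family unchanged would put the potential of
   [Q] below itself. *)
by have := potential_upd QP ik bP ub; rewrite /improvement in lt same; rewrite same; lia.
Qed.

(* Five times the local optimality condition plus what is to be proved about a
   vertex with [sg] sources, visited by [c'] of our paths and [ev] optimal walks. *)
Lemma visit_load_ineq sg c' ev : sg <= c' -> sg <= ev -> 0 < ev ->
  17 * c' + 32 * (c' == 0) + 32 * sg + 5 * (ev * visit_cost (2 * sg + c')) <=
  32 * ev + 17 * sg + 5 * (c' * visit_cost ((2 * sg + c').-1)).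
Proof.
case: sg => [|sg] sc se e0.
  (* Without sources, equality holds for [ev = 1] at [c' = 0] and at [c' = 1]; from [c' = 3] on
     every price is 4. *)
  by rewrite muln0 add0n; case: c' {sc} => [|[|[|c]]]; rewrite /visit_cost /=; lia.
(* At a source the doubled count together with the path starting there gives at least 3 visits, so
   the price is 4 even without the own visit. What remains is [15 * sg <= 12 * ev + 3 * c'], with
   [sg] now the full number of sources. *)
have -> : 2 * sg.+1 + c' = (2 * sg + c').-1.+3 by lia.
by rewrite /visit_cost /=; lia.
Qed.

Lemma source_load_le Q v : walks_ok Q -> source_load v <= path_load Q v.
Proof.
move=> [_ QP]; apply: leq_sum => i _; case: eqP => // <-.
by rewrite (is_walk_nat_source (QP i (ltn_ord i))).
Qed.

Lemma path_load_gt0 Q v : size Q = k -> (0 < path_load Q v) = (v \in flatten Q).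
Proof.
move=> Qk; apply/idP/flatten_nthP; last first.
  by case=> i; rewrite Qk => ik vi; apply: leq_trans (path_load_ge Q v ik); rewrite vi.
move=> vQ; apply: contrapT => none; move: vQ; rewrite lt0n => /negP; apply.
rewrite sum_nat_eq0; apply/forallP => i; rewrite eqb0; apply/negP => vi.
by apply: none; exists i; rewrite ?Qk.
Qed.

Lemma sum_source_load : \sum_(v < n) source_load v = k.
Proof.
under eq_bigr => v _ do rewrite -count_sources.
rewrite sum_count_mem -[RHS](size_map fst); apply/eqP; rewrite -all_count.
apply/(all_nthP 0) => i; rewrite size_map => ik; rewrite (nth_map (0, 0)) //.
by case: (pairs_lt ik).
Qed.

Lemma walks_ok_size Q i : walks_ok Q -> i < k ->
  (size (nth [::] Q i)).-1.+1 = size (nth [::] Q i).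
Proof. by move=> [_ QP] /QP/is_walk_nat_size; case: size. Qed.

Lemma sum_path_load Q : paths_ok Q -> \sum_(v < n) path_load Q v = total_length Q + k.
Proof.
move=> [QP uQ]; rewrite exchange_big total_lengthE (proj1 QP) /=.
have kE : \sum_(i < k) 1 = k by rewrite sum1_card card_ord.
rewrite -[X in _ + X]kE -big_split /=; apply: eq_bigr => i _.
rewrite addn1 (walks_ok_size QP) // -[RHS]sum1_size.
rewrite (sum_uniq_ord (n := n) (fun=> 1)); [|exact: uQ|move=> x; exact: walks_ok_lt QP _].
by apply: eq_bigr => v _; rewrite muln1.
Qed.

(** Only an inequality, because an arbitrary walk may pass a vertex several times while [path_load]
    counts it once. *)
Lemma sum_path_load_le P : walks_ok P -> \sum_(v < n) path_load P v <= total_length P + k.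
Proof.
move=> PP; rewrite exchange_big total_lengthE (proj1 PP) /=.
have kE : \sum_(i < k) 1 = k by rewrite sum1_card card_ord.
rewrite -[X in _ + X]kE -big_split /=; apply: leq_sum => i _.
rewrite addn1 (walks_ok_size PP) //; apply: leq_trans (size_undup _).
rewrite -[leqRHS]sum1_size (sum_uniq_ord (n := n) (fun=> 1)) ?undup_uniq //.
  by apply: leq_sum => v _; rewrite muln1 mem_undup.
by move=> x; rewrite mem_undup; apply: walks_ok_lt PP _.
Qed.

Lemma sum_visit_cost_le Q P i : paths_ok Q -> locally_optimal Q -> walks_ok P -> i < k ->
  \sum_(v < n) ((v : nat) \in nth [::] Q i) * visit_cost (load Q v).-1 <=
  \sum_(v < n) ((v : nat) \in nth [::] P i) * visit_cost (load Q v).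
Proof.
move=> QP Qopt PP ik; have [w [wP uw sub]] := is_walk_nat_shorten (proj2 PP i ik).
have [sn tn] := pairs_lt ik.
have wn := uniq_walk_size edge_lt sn wP uw.
have wlt := is_walk_nat_lt edge_lt sn wP.
have Qlt v : v \in nth [::] Q i -> v < n by apply: walks_ok_lt (proj1 QP) ik.
pose cost (u : seq nat) := \sum_(v < n) ((v : nat) \in u) *
  visit_cost (load Q v - ((v : nat) \in nth [::] Q i)).
have weightE (u : seq nat) : uniq u -> (forall v, v \in u -> v < n) ->
    weight (prices M prs Q i) u = cost u * n.+1 + size u.
  move=> uu un; rewrite weight_prices // big_distrl -(sum1_size u) /=.
  rewrite (sum_uniq_ord (fun=> 1) uu un) -big_split /=; apply: eq_bigr => v _.
  by rewrite /price mulnDr mulnA.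
have := Qopt i w ik wP; rewrite !weightE //; last exact: (proj2 QP).
move=> le; have {}le : cost (nth [::] Q i) <= cost w by nia.
apply: leq_trans (leq_trans le _).
  by apply: eq_leq; apply: eq_bigr => v _; case: (_ \in _); rewrite ?mul0n // subn1.
apply: leq_sum => v _; apply: leq_mul.
  by case vw: (_ \in w) => //; rewrite sub.
by apply: visit_cost_le; apply: leq_subr.
Qed.

Definition uncovered Q := \sum_(v < n) ((v : nat) \notin flatten Q).

Lemma local_optimum_bound Q P : paths_ok Q -> locally_optimal Q -> walks_ok P ->
  (forall v, v < n -> v \in flatten P) ->
  17 * total_length Q + 32 * uncovered Q <= 32 * total_length P.
Proof.
move=> QP Qopt PP Pcov.
have le1 : \sum_(v < n) path_load Q v * visit_cost (load Q v).-1 <=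
           \sum_(v < n) path_load P v * visit_cost (load Q v).
  rewrite /path_load; under eq_bigr do rewrite big_distrl.
  under [leqRHS]eq_bigr do rewrite big_distrl.
  rewrite exchange_big [leqRHS]exchange_big /=; apply: leq_sum => i _.
  exact: sum_visit_cost_le.
have le2 : 17 * (\sum_(v < n) path_load Q v) + 32 * uncovered Q
    + 32 * (\sum_(v < n) source_load v)
    + 5 * (\sum_(v < n) path_load P v * visit_cost (load Q v)) <=
    32 * (\sum_(v < n) path_load P v) + 17 * (\sum_(v < n) source_load v)
    + 5 * (\sum_(v < n) path_load Q v * visit_cost (load Q v).-1).
  rewrite !(@big_distrr _ _ muln) /= -!big_split /=; apply: leq_sum => v _.
  rewrite (loadE v QP) -path_load_gt0 ?(proj1 (proj1 QP)) // -eqn0Ngt.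
  apply: visit_load_ineq; try exact: source_load_le; last first.
    by rewrite path_load_gt0 ?(proj1 PP) // Pcov.
  exact: source_load_le (proj1 QP).
(* The loads count vertices, one more per walk than edges. The source terms, which sum to [k],
   remove exactly this excess on both sides. *)
move: le2; rewrite sum_path_load //.
by have := sum_path_load_le PP; rewrite sum_source_load; lia.
Qed.

(** * Covering the missed vertices by detours *)

Hypothesis edge_sym : forall u v, e u v = e v u.

Lemma is_walk_nat_rev s t w : is_walk_nat M s t w -> is_walk_nat M t s (rev w).
Proof.
case: w => //= x p /and3P[/eqP-> pp /eqP lt].
rewrite lastI rev_rcons /= lt eqxx /=; apply/andP; split.
  have := rev_path e s p; rewrite lt => ->.
  by rewrite (@eq_path _ _ e) // => u v; rewrite edge_sym.
by case: p {pp} lt => /= [->|y p _]; rewrite ?eqxx // rev_cons last_rcons eqxx.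
Qed.

Lemma is_walk_nat_detour s t a u v b : e u v -> is_walk_nat M s t (a ++ u :: b) ->
  is_walk_nat M s t (a ++ [:: u, v, u & b]).
Proof.
move=> uv; case: a => [|x a] /=; first by rewrite uv (edge_sym v u) uv.
by rewrite !cat_path !last_cat /= uv (edge_sym v u) uv.
Qed.

Lemma head_filter_iota (m : nat) (P : pred nat) i : i < m -> P i ->
  head 0 [seq j <- iota 0 m | P j] < m /\ P (head 0 [seq j <- iota 0 m | P j]).
Proof.
move=> im Pi; have : i \in [seq j <- iota 0 m | P j] by rewrite mem_filter Pi mem_iota.
move=> ij; have : head 0 [seq j <- iota 0 m | P j] \in [seq j <- iota 0 m | P j].
  by case: filter ij => //= y l _; rewrite mem_head.
by rewrite mem_filter mem_iota => /andP[].
Qed.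

Lemma flatten_upd Q i w x : i < size Q -> {subset nth [::] Q i <= w} ->
  (x \in flatten (upd Q i w)) = (x \in flatten Q) || (x \in w).
Proof.
move=> iQ sub; apply/flatten_nthP/idP => [[j]|].
  rewrite size_upd => jQ; rewrite nth_upd //; case: eqP => _ xj.
    by rewrite xj orbT.
  by apply/orP; left; apply/flatten_nthP; exists j.
case/orP => [/flatten_nthP[j jQ xj]|xw]; last first.
  by exists i; rewrite ?size_upd // nth_upd // eqxx.
exists j; rewrite ?size_upd // nth_upd //; case: eqP => // ji.
by apply: sub; rewrite -ji.
Qed.

Lemma total_length_upd Q i w : size Q = k -> i < k ->
  total_length (upd Q i w) + (size (nth [::] Q i)).-1 = total_length Q + (size w).-1.
Proof.
move=> Qk ik; rewrite !total_lengthE size_upd Qk.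
exact: (sum_upd (fun u => (size u).-1)).
Qed.

(** A detour has length 2 and covers exactly one new vertex, so length plus twice the number of
    uncovered vertices is invariant. *)
Lemma detourE Q i v u : walks_ok Q -> i < k -> v < n -> v \notin flatten Q ->
  u \in nth [::] Q i -> e u v ->
  [/\ walks_ok (detour M Q i v), uncovered (detour M Q i v) < uncovered Q &
    total_length (detour M Q i v) + 2 * uncovered (detour M Q i v) =
    total_length Q + 2 * uncovered Q].
Proof.
move=> QP ik vn vQ ui uv; rewrite /detour (negbTE vQ) orbF.
set w := nth [::] Q i in ui *; rewrite /neighbors.
have iu : index u w < size w by rewrite index_mem.
have eiu : e (nth 0 w (index u w)) v by rewrite nth_index.
have [] := head_filter_iota (P := fun j => e (nth 0 w j) v) iu eiu.
have : index u w \in [seq j <- iota 0 (size w) | e (nth 0 w j) v].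
  by rewrite mem_filter eiu mem_iota.
case: filter => //= j _ _ jw ejv.
have wE : w = take j w ++ nth 0 w j :: drop j.+1 w by rewrite -drop_nth // cat_take_drop.
set w' := take j.+1 w ++ v :: drop j w.
have w'E : w' = take j w ++ [:: nth 0 w j, v, nth 0 w j & drop j.+1 w].
  by rewrite /w' (take_nth 0) // cat_rcons -drop_nth.
have wP : is_walk_nat M (src i) (tgt i) w' by rewrite w'E is_walk_nat_detour // -wE; apply: QP.2.
have memw' x : (x \in w') = (x \in w) || (x == v).
  by rewrite w'E [in RHS]wE !mem_cat !inE; do !case: (_ \in _); do !case: (_ == _).
have iQ : i < size Q by rewrite QP.1.
have memF x : (x \in flatten (upd Q i w')) = (x \in flatten Q) || (x == v).
  rewrite flatten_upd //; last by move=> y yw; rewrite memw' yw.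
  rewrite memw' orbA; congr (_ || _); apply/orb_idr => xw.
  by apply/flatten_nthP; exists i.
have unc : uncovered Q = uncovered (upd Q i w') + 1.
  have -> : 1 = \sum_(x < n) ((x : nat) == v).
    rewrite (bigD1 (Ordinal vn)) //= eqxx big1 // => x xv.
    by apply/eqP; rewrite eqb0; apply: contraNneq xv => xv; apply/eqP/val_inj.
  rewrite -big_split /=; apply: eq_bigr => x _; rewrite memF.
  by case: eqP => [->|_]; rewrite ?orbT ?orbF ?addn0 ?vQ.
split; [exact: walks_ok_upd | by rewrite unc addn1 |].
have := total_length_upd w' QP.1 ik; rewrite -/w unc.
have -> : size w' = (size w).+2.
  by have := congr1 size wE; rewrite w'E !size_cat /=; lia.
by have := is_walk_nat_size (QP.2 i ik); rewrite -/w; lia.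
Qed.

Definition cover_inv m Q := walks_ok Q /\ total_length Q + 2 * uncovered Q = m.

Lemma detour_decreasing m Q i v : i < k -> v < n -> cover_inv m Q ->
  cover_inv m (detour M Q i v) /\
  (detour M Q i v = Q \/ uncovered (detour M Q i v) < uncovered Q).
Proof.
move=> ik vn [QP QE]; case vQ: (v \in flatten Q).
  by rewrite /detour vQ orbT; split; [|left].
case: (altP (@hasP _ (e^~ v) (nth [::] Q i))) => [[u ui uv]|none].
  have [dP du dE] := detourE QP ik vn (negbT vQ) ui uv.
  by split; [split; rewrite ?dE | right].
have -> : detour M Q i v = Q; last by split; [|left].
rewrite /detour /neighbors; set js := filter _ _.
have -> : js = [::]; last by [].
apply/eqP; rewrite -[_ == _]negbK -has_filter; apply/negP => /hasP[j].
rewrite mem_iota /= => jw ej; case/negP: none; apply/hasP; exists (nth 0 (nth [::] Q i) j) => //.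
exact: mem_nth.
Qed.

Lemma path_exits (A : pred nat) x p : path e x p -> A x -> ~~ A (last x p) ->
  exists u v, [/\ e u v, A u & ~~ A v].
Proof.
elim: p x => [|y p IHp] x /=; first by move=> _ ->.
move=> /andP[xy pp] Ax; case Ay: (A y); first exact: IHp.
by move=> _; exists x, y; rewrite xy Ax Ay.
Qed.

(** The process ends in a family that no detour changes. By connectivity such a family covers
    everything, and the invariant then gives its exact length. *)
Lemma coverP Q : 0 < k -> walks_ok Q ->
  [/\ walks_ok (cover_all M prs Q), forall v, v < n -> v \in flatten (cover_all M prs Q) &
    total_length (cover_all M prs Q) = total_length Q + 2 * uncovered Q].
Proof.
move=> k0 QP; set m := total_length Q + 2 * uncovered Q.
have inner i Q' v : i < k -> v \in iota 0 n -> cover_inv m Q' ->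
    cover_inv m (detour M Q' i v) /\
    (detour M Q' i v = Q' \/ uncovered (detour M Q' i v) < uncovered Q').
  by rewrite mem_iota => ik vn; apply: detour_decreasing.
have middle i Q' : i \in iota 0 k -> cover_inv m Q' ->
    cover_inv m (detours M Q' i) /\
    (detours M Q' i = Q' \/ uncovered (detours M Q' i) < uncovered Q').
  rewrite mem_iota => ik; apply: foldl_decreasing => v Q'' vn; exact: inner.
have outer Q' : cover_inv m Q' -> cover_inv m (cover_round M prs Q') /\
    (cover_round M prs Q' = Q' \/ uncovered (cover_round M prs Q') < uncovered Q').
  exact: foldl_decreasing.
have un : uncovered Q < n.+1.
  rewrite ltnS -[n in leqRHS]card_ord -sum1_card; apply: leq_sum => v _.
  exact: leq_b1.
have [[CP CE] Cfix] := iter_decreasing outer (conj QP erefl) un.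
rewrite -/(cover_all M prs Q) in CP CE Cfix; set C := cover_all M prs Q in CP CE Cfix *.
have fixed i v : i < k -> v < n -> detour M C i v = C.
  move=> ik vn; have ii : i \in iota 0 k by rewrite mem_iota.
  have vi : v \in iota 0 n by rewrite mem_iota.
  have fi := foldl_fixed middle (conj CP CE) Cfix ii.
  exact: (foldl_fixed (f := fun Q v => detour M Q i v)
    (fun v Q' => inner i Q' v ik) (conj CP CE) fi vi).
have covered v : v < n -> v \in flatten C.
  move=> vn; apply: contraT => vC; have [sn _] := pairs_lt k0.
  have sC : src 0 \in flatten C.
    by apply/flatten_nthP; exists 0; rewrite ?CP.1 // (is_walk_nat_source (CP.2 _ k0)).
  have [[//|x p] /= /and3P[/eqP xs pp /eqP lv]] := connected sn vn.
  rewrite xs in pp lv; rewrite -lv in vC.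
  have [u [y [uy uC yC]]] := path_exits (A := fun y => y \in flatten C) pp sC vC.
  have /flatten_nthP[i iC ui] := uC; rewrite CP.1 in iC.
  have /andP[_ yn] := edge_lt uy.
  (* The edge leaving the covered set permits a detour that strictly lowers the number of uncovered
     vertices, yet this detour fixes [C]. *)
  by have [_ + _] := detourE CP iC yn yC ui uy; rewrite fixed // ltnn.
split=> //; rewrite -/m -CE; have -> : uncovered C = 0; last by rewrite muln0 addn0.
by rewrite /uncovered big1 // => v _; rewrite covered.
Qed.

(** * Passing between depot tours and walks *)

Lemma attachP Q c d : walks_ok Q -> d \in sources prs -> is_walk_nat M d d c ->
  [/\ walks_ok (attach prs Q c),
    total_length (attach prs Q c) = total_length Q + (size c).-1 &
    forall x, (x \in flatten Q) || (x \in c) -> x \in flatten (attach prs Q c)].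
Proof.
move=> QP dS cP; have hc : head 0 c = d by rewrite (is_walk_nat_head cP).
have dk : index d (sources prs) < k by rewrite -(size_map fst) index_mem.
have [] := head_filter_iota (P := fun j => nth 0 (sources prs) j == head 0 c) dk _.
  by rewrite nth_index // hc.
rewrite -/(depot_index prs c) /attach; set i := depot_index prs c => ik.
rewrite (nth_map (0, 0)) // hc => /eqP si.
have wP := QP.2 i ik; set w := nth [::] Q i in wP *.
have iQ : i < size Q by rewrite QP.1.
(* The removed first vertex of [w] is the depot, which [c] visits. *)
have sub : {subset w <= c ++ behead w}.
  move=> x; rewrite {1}(is_walk_nat_head wP) inE mem_cat => /predU1P[->|->]; last by rewrite orbT.
  by rewrite si (is_walk_nat_source cP).
split.
- by apply: walks_ok_upd => //; apply: is_walk_nat_cat wP; rewrite si.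
- have := total_length_upd (c ++ behead w) QP.1 ik; rewrite -/w size_cat size_behead.
  by have := is_walk_nat_size wP; have := is_walk_nat_size cP; lia.
by move=> x; rewrite flatten_upd // mem_cat orbA => ->.
Qed.

Lemma extend_toursP C :
  (forall c, c \in C -> exists2 d, d \in sources prs & is_walk_nat M d d c) ->
  [/\ walks_ok (extend_tours M prs C),
    total_length (extend_tours M prs C) =
      total_length (shortest_walks M prs) + total_length C &
    forall x, x \in flatten C -> x \in flatten (extend_tours M prs C)].
Proof.
move=> CP; rewrite /extend_tours; have := proj1 shortest_walks_ok.
set Q := shortest_walks M prs => QP.
suff [] : [/\ walks_ok (foldl (attach prs) Q C),
    total_length (foldl (attach prs) Q C) = total_length Q + total_length C &
    forall x, (x \in flatten Q) || (x \in flatten C) ->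
      x \in flatten (foldl (attach prs) Q C)].
  by move=> fP fE fM; split=> // x xC; apply: fM; rewrite xC orbT.
elim: C Q QP CP => [|c C IHC] Q QP CP /=.
  by rewrite /total_length addn0; split=> // x; rewrite orbF.
have [d dS cP] := CP c (mem_head _ _).
have [aP aE aM] := attachP QP dS cP.
have [|fP fE fM] := IHC _ aP.
  by move=> c' c'C; apply: CP; rewrite inE c'C orbT.
split=> //; first by rewrite fE aE /total_length /= addnA.
move=> x; rewrite mem_cat orbA => /orP[xQc|xC]; apply: fM; last by rewrite xC orbT.
by rewrite aM.
Qed.

Section Tours.
Variables P R : seq (seq nat).
Hypotheses (PP : walks_ok P) (RP : walks_ok R).

(** Out along the walk of [P] and back along the reversed walk of [R]. The initial source is omitted
    so that round trips from the same depot can be concatenated after it. *)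
Definition round_trip i := behead (nth [::] P i) ++ behead (rev (nth [::] R i)).
Definition tour d := d :: flatten [seq round_trip i | i <- iota 0 k & src i == d].

Lemma tour_walk d : is_walk_nat M d d (tour d).
Proof.
rewrite /tour; have : all (fun i => (i < k) && (src i == d)) [seq i <- iota 0 k | src i == d].
  by apply/allP => i; rewrite mem_filter mem_iota andbC.
elim: [seq i <- _ | _] => [|i l IHl] /=; first by rewrite !eqxx.
move=> /andP[/andP[ik /eqP id] /IHl lP].
have wP := PP.2 i ik; have rP := is_walk_nat_rev (RP.2 i ik).
have := is_walk_nat_cat (is_walk_nat_cat wP rP) (eq_rect_r (fun s => is_walk_nat M s d _) lP id).
rewrite (is_walk_nat_head wP) /= /round_trip.
by rewrite id -catA.
Qed.

Lemma tour_length d :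
  (size (tour d)).-1 =
  \sum_(i < k) (src i == d) * ((size (nth [::] P i)).-1 + (size (nth [::] R i)).-1).
Proof.
rewrite /tour /= size_flatten /shape -map_comp sumnE big_map big_filter big_mkcond /=.
rewrite -[k in LHS]subn0 -/(index_iota 0 k) big_mkord; apply: eq_bigr => i _.
by case: ifP => _; rewrite ?mul1n ?mul0n //= /round_trip size_cat !size_behead size_rev.
Qed.

Lemma mem_tour i v : i < k -> v \in nth [::] P i -> v \in tour (src i).
Proof.
move=> ik; rewrite (is_walk_nat_head (PP.2 i ik)) !inE => /predU1P[->|vi].
  by rewrite eqxx.
apply/orP; right; apply/flattenP; exists (round_trip i).
  by apply: map_f; rewrite mem_filter eqxx mem_iota.
by rewrite mem_cat vi.
Qed.

(** Each pair is charged at exactly one depot, its source. *)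
Lemma sum_tour_length (ds : seq nat) : uniq ds ->
  (forall i, i < k -> src i \in ds) ->
  total_length (map tour ds) = total_length P + total_length R.
Proof.
move=> uds dsP; rewrite /total_length sumnE !big_map.
under eq_bigr do rewrite tour_length; rewrite exchange_big /=.
rewrite -/(total_length P) -/(total_length R) !total_lengthE PP.1 RP.1 -big_split /=.
apply: eq_bigr => i _; rewrite -big_distrl /= (bigD1_seq (src i)) //=; last exact: dsP.
by rewrite eqxx big1 ?mul1n // => d dn; rewrite eq_sym (negbTE dn).
Qed.
End Tours.

End MultiPath.

(** * Instances as lists of numbers *)

Definition matrix_of (I : instance) :=
  [seq [seq adj x y | y <- enum (vertex I)] | x <- enum (vertex I)].

Definition pairs_of (I : instance) : seq (nat * nat) :=
  [seq (val st.1, val st.2) | st <- pairs I].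

Definition data_of (I : instance) := (matrix_of I, pairs_of I).

Definition numbers_of n (P : seq (seq 'I_n)) : seq (seq nat) := map (map val) P.

Lemma enc_seq_map S T (f : T -> tree) (g : S -> T) s :
  enc_seq f (map g s) = enc_seq (fun x => f (g x)) s.
Proof. by elim: s => //= x s ->. Qed.

Lemma eq_enc_seq T (f g : T -> tree) s : f =1 g -> enc_seq f s = enc_seq g s.
Proof. by move=> fg; elim: s => //= x s ->; rewrite fg. Qed.

Lemma enc_data_of I : enc (data_of I) = enc_instance I.
Proof.
rewrite /enc /= /enc_instance !enc_seq_map; congr Node.
by apply: eq_enc_seq => x; rewrite /enc /= enc_seq_map.
Qed.

Lemma enc_numbers_of n (P : seq (seq 'I_n)) : enc (numbers_of P) = enc_solution P.
Proof.
rewrite /enc /= enc_seq_map; apply: eq_enc_seq => w.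
by rewrite /enc /= enc_seq_map.
Qed.

Lemma total_length_numbers_of n (P : seq (seq 'I_n)) :
  total_length (numbers_of P) = cost P.
Proof.
rewrite /total_length /cost sumnE !big_map; apply: eq_bigr => w _.
by rewrite size_map.
Qed.

Lemma mem_numbers_of n (P : seq (seq 'I_n)) (v : 'I_n) :
  ((v : nat) \in flatten (numbers_of P)) = has (fun w => v \in w) P.
Proof.
rewrite /numbers_of -map_flatten mem_map; last exact: val_inj.
apply/flattenP/hasP => [[w wP vw]|[w wP vw]]; by exists w.
Qed.

Lemma pmap_insubK n (w : seq nat) : (forall v, v \in w -> v < n) ->
  map val (pmap (insub : nat -> option 'I_n) w) = w.
Proof.
elim: w => //= v w IHw wn; rewrite (insubT (fun i => i < n) (wn v (mem_head _ _))) /=.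
by rewrite IHw // => u uw; apply: wn; rewrite inE uw orbT.
Qed.

Definition feasible_nat M prs Q :=
  walks_ok M prs Q /\ forall v, v < size M -> v \in flatten Q.

Section Instance.
Variable I : instance.
Let M := matrix_of I.
Let prs := pairs_of I.
Let n := Defs.order (graph I).

Lemma size_matrix_of : size M = n.
Proof. by rewrite size_map size_enum_ord. Qed.

Lemma edge_ord (u v : vertex I) : edge M u v = adj u v.
Proof.
rewrite /edge (nth_map u) ?size_enum_ord // nth_ord_enum.
by rewrite (nth_map u) ?size_enum_ord // nth_ord_enum.
Qed.

(** Reading outside the matrix returns the default [false]. *)
Lemma matrix_edge_lt u v : edge M u v -> (u < size M) && (v < size M).
Proof.
rewrite size_matrix_of /edge => uv.
have un : u < n.
  by rewrite ltnNge; apply: contraL uv => nu; rewrite [nth _ M u]nth_default ?nth_nil // size_matrix_of.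
rewrite un /= ltnNge; apply: contraL uv => nv.
rewrite (nth_map (Ordinal un)) ?size_enum_ord // nth_default //.
by rewrite size_map size_enum_ord.
Qed.

Lemma matrix_edge_sym u v : edge M u v = edge M v u.
Proof.
suff sub x y : edge M x y -> edge M y x by apply/idP/idP; apply: sub.
move=> xy; have := matrix_edge_lt xy; rewrite size_matrix_of => /andP[xn yn].
move: xy; rewrite (edge_ord (Ordinal xn) (Ordinal yn)) (edge_ord (Ordinal yn) (Ordinal xn)).
by rewrite adj_sym.
Qed.

Lemma is_walk_val (s t : vertex I) w :
  is_walk s t w = is_walk_nat M s t (map val w).
Proof.
case: w => //= x p; rewrite (inj_eq val_inj) (last_map val p x) (inj_eq val_inj).
congr [&& _, _ & _]; elim: p x => //= y p IHp x.
by rewrite IHp edge_ord.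
Qed.

Lemma matrix_connected u v : u < size M -> v < size M -> exists w, is_walk_nat M u v w.
Proof.
rewrite size_matrix_of => un vn.
have /connectP[p pp lp] := adj_connected (Ordinal un) (Ordinal vn).
exists (map val (Ordinal un :: p)).
by rewrite -(is_walk_val (Ordinal un) (Ordinal vn)) /= eqxx pp -lp eqxx.
Qed.

Lemma pairs_of_lt i : i < size prs ->
  (nth (0, 0) prs i).1 < size M /\ (nth (0, 0) prs i).2 < size M.
Proof.
rewrite size_matrix_of size_map => ip.
case E: (pairs I) ip => [//|st0 l] ip; rewrite -E in ip.
by rewrite (nth_map st0) /= ?ltn_ord //; split; exact: ltn_ord.
Qed.

Lemma pairs_of_gt0 : 0 < size prs.
Proof. by rewrite size_map pairs_neq0. Qed.

Lemma feasible_numbers_of P : feasible I P <-> feasible_nat M prs (numbers_of P).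
Proof.
have nthP i st : i < size (pairs I) -> size P = size (pairs I) ->
    is_walk (nth st (pairs I) i).1 (nth st (pairs I) i).2 (nth [::] P i) =
    is_walk_nat M (nth (0, 0) prs i).1 (nth (0, 0) prs i).2 (nth [::] (numbers_of P) i).
  by move=> ip sP; rewrite is_walk_val !(nth_map st) // (nth_map [::]) // sP.
rewrite /feasible all2E; split.
  move=> /andP[/andP[/eqP sP /allP wP] /forallP cov]; split; last first.
    move=> v; rewrite size_matrix_of => vn.
    by rewrite (mem_numbers_of P (Ordinal vn)) cov.
  split=> [|i]; rewrite ?size_map // => ip.
  case E: (pairs I) (ip) => [//|st l] _.
  rewrite -(nthP i st) //; apply: (wP (_, _)).
  rewrite -nth_zip //; apply: mem_nth.
  by rewrite size_zip -sP minnn.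
move=> [[sP wP] cov]; rewrite !size_map in sP wP.
rewrite sP eqxx /=; apply/andP; split; last first.
  by apply/forallP => v; rewrite -mem_numbers_of cov // size_matrix_of.
case E: (pairs I) => [|st l]; first by case: (P).
rewrite -E; apply/(all_nthP (st, [::])) => i; rewrite size_zip sP minnn => ip /=.
by rewrite nth_zip //= nthP // wP.
Qed.

Lemma numbers_of_surj Q : feasible_nat M prs Q ->
  exists2 P : seq (seq (vertex I)), numbers_of P = Q & feasible I P.
Proof.
move=> QP; pose P := map (pmap (insub : nat -> option (vertex I))) Q.
have PQ : numbers_of P = Q.
  rewrite /numbers_of -map_comp -[RHS]map_id; apply/eq_in_map => w wQ /=.
  apply: pmap_insubK => v vw; have [[sQ wP] _] := QP.
  have iQ : index w Q < size prs by rewrite -sQ index_mem.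
  rewrite -/n -size_matrix_of.
  apply: (walks_ok_lt matrix_edge_lt pairs_of_lt (conj sQ wP) iQ).
  by rewrite nth_index.
by exists P => //; apply/feasible_numbers_of; rewrite PQ.
Qed.
End Instance.

(** [approx_solution] bounds the cost only against optimal solutions, so one has to exist; it is
    reached by descent on the cost from any feasible solution. *)
Lemma optimal_exists I P : feasible I P -> exists2 Q, optimal I Q & cost Q <= cost P.
Proof.
have [m Pm] := ubnP (cost P); elim: m P Pm => // m IHm P Pm fP.
case: (pselect (forall Q : seq (seq (vertex I)), feasible I Q -> cost P <= cost Q)) => [opt|].
  by exists P.
move=> /existsNP[Q /not_implyP[fQ /negP]]; rewrite -ltnNge => QP.
have [Q' optQ' Q'Q] := IHm Q (leq_trans QP Pm) fQ.
by exists Q' => //; apply: leq_trans (ltnW QP).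
Qed.

(** The depots form a legal instance on the same graph: each source occurs once, and there is one
    because [I] has a pair. *)
Lemma depot_instance I : exists I' : instance,
  [/\ graphic_multi_depot_vrp I', matrix_of I' = matrix_of I &
      pairs_of I' = depots (matrix_of I) (pairs_of I)].
Proof.
pose ds := [seq d <- enum (vertex I) | d \in map fst (pairs I)].
pose prs := [seq (d, d) | d <- ds].
have uds : uniq ds := filter_uniq _ (enum_uniq _).
have uprs : uniq prs by rewrite map_inj_uniq // => u v [].
have prs0 : 0 < size prs.
  rewrite size_map; have := pairs_neq0 I; case E: (pairs I) => [//|st l] _.
  have : st.1 \in ds by rewrite mem_filter E inE eqxx mem_enum.
  by case: (ds).
exists (@Instance (graph I) prs uprs prs0); split=> //.
  by move=> st /mapP[d _ ->].
rewrite /pairs_of /= /depots size_matrix_of /prs -map_comp.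
rewrite -[X in iota 0 X]/(Defs.order (graph I)) -val_enum_ord filter_map -map_comp.
congr map; apply: eq_filter => d /=.
by rewrite /sources /pairs_of -map_comp (map_comp val fst) mem_map //; apply: val_inj.
Qed.

(** Comparing with all feasible families allows a direct comparison with the tours built from an
    arbitrary solution, optimal or not. *)
Definition approx_nat (R : realType) (alpha : R) (M : seq (seq bool)) prs Q :=
  feasible_nat M prs Q /\
  forall Q', feasible_nat M prs Q' ->
    ((total_length Q)%:R <= alpha * (total_length Q')%:R)%R.

Import Order.TTheory GRing.Theory Num.Theory.
Local Open Scope ring_scope.

(** * The approximation factor *)

Section Reduction.
Variables (R : realType) (delta : R).
Hypotheses (delta_gt0 : 0 < delta) (delta_le1 : delta <= 1).

Lemma solve_approx I (M := matrix_of I) (prs := pairs_of I) C :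
  approx_nat (2 - delta) M (depots M prs) C ->
  approx_nat (2 - delta / 49) M prs (solve M prs C).
Proof.
move=> [[[sC wC] covC] optC].
have elt := @matrix_edge_lt I; have esym := @matrix_edge_sym I.
have con := @matrix_connected I; have plt := @pairs_of_lt I.
rewrite -/M -/prs in elt esym con plt.
have k0 : (0 < size prs)%N := pairs_of_gt0 I.
have depotsE i : (i < size (depots M prs))%N ->
    (nth (0%N, 0%N) (depots M prs) i).1 = (nth (0%N, 0%N) (depots M prs) i).2 /\
    (nth (0%N, 0%N) (depots M prs) i).1 \in sources prs.
  rewrite size_map => id; rewrite (nth_map 0%N) //=; split=> //.
  by have := mem_nth 0%N id; rewrite mem_filter => /andP[].
have Cwalk c : c \in C -> exists2 d, d \in sources prs & is_walk_nat M d d c.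
  move=> cC; have ci : (index c C < size (depots M prs))%N by rewrite -sC index_mem.
  have [d12 ds] := depotsE _ ci.
  exists (nth (0%N, 0%N) (depots M prs) (index c C)).1 => //.
  by have := wC _ ci; rewrite nth_index // -d12.
have [eP eE eM] := extend_toursP elt con plt Cwalk.
have [lP lopt] := local_searchP elt con plt.
have [cP ccov cE] := coverP elt con plt esym k0 (proj1 lP).
have solE : total_length (solve M prs C) =
    minn (total_length (extend_tours M prs C))
         (total_length (cover_all M prs (local_search M prs))).
  by rewrite /solve; case: leqP.
split.
  rewrite /solve; case: ifP => _; last exact: conj cP ccov.
  by split=> // v vM; apply/eM/covC; rewrite // size_map.
move=> P [PP Pcov].
have bound := local_optimum_bound elt plt lP lopt PP Pcov.
have short := shortest_walks_min elt con plt (proj1 lP).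
set D := total_length (shortest_walks M prs) in short eE.
pose ds := [seq v <- iota 0 (size M) | v \in sources prs].
have uds : uniq ds by rewrite filter_uniq ?iota_uniq.
have dsP i : (i < size prs)%N -> (nth (0%N, 0%N) prs i).1 \in ds.
  move=> ik; rewrite mem_filter mem_iota /= (plt i ik).1 andbT.
  by apply: map_f; apply: mem_nth.
have SP := proj1 (shortest_walks_ok elt con plt).
have tE := sum_tour_length PP SP uds dsP.
(* The tours close up [P] by shortest walks, so their total length is that of [P] plus [D]. *)
have /optC : feasible_nat M (depots M prs) (map (tour prs P (shortest_walks M prs)) ds).
  split; [split=> [|i]|move=> v vM]; first by rewrite size_map [in RHS]size_map.
    rewrite size_map => id; rewrite !(nth_map 0%N) //=.
    exact: tour_walk.
  have /flatten_nthP[i iP vi] := Pcov v vM; rewrite PP.1 in iP.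
  apply/flattenP; exists (tour prs P (shortest_walks M prs) (nth (0%N, 0%N) prs i).1).
    by apply: map_f; apply: dsP.
  exact: (mem_tour _ PP iP vi).
rewrite tE -/D natrD => Cle.
set c := total_length (solve M prs C); set c1 := total_length (extend_tours M prs C) in eE solE.
set c2 := total_length (cover_all M prs (local_search M prs)) in cE solE.
have cc1 : (c <= c1)%N by rewrite /c solE geq_minl.
(* With [q] and [u] the length and the number of missed vertices after the local search,
   [c <= q + 2 * u] and [D <= q], while the bound reads [17 * q + 32 * u <= 32 * total_length P]. *)
have cc2 : (16 * c + D <= 32 * total_length P)%N.
  have : (c <= c2)%N by rewrite /c solE geq_minr.
  by move: bound short; rewrite cE; lia.
rewrite eE -(ler_nat R) natrD in cc1; rewrite -(ler_nat R) natrD !natrM in cc2.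
move: Cle cc1 cc2.
have D0 : 0 <= D%:R :> R := ler0n _ _.
move: (D%:R) (c%:R) ((total_length P)%:R) ((total_length C)%:R) D0 => d x p y d0 *.
(* Averaging [x <= d + y] and [16 x + d <= 32 p] with weights 1 : 48 cancels [d]. *)
have := mulr_ge0 (ltW delta_gt0) d0; lra.
Qed.
End Reduction.

(** A feasible solution costs at least the optimum, and a nonnegative [beta] preserves this
    comparison. *)
Lemma approx_nat_of_solution (R : realType) (alpha beta : R) I P :
  alpha <= beta -> 0 <= beta -> approx_solution alpha I P ->
  approx_nat beta (matrix_of I) (pairs_of I) (numbers_of P).
Proof.
move=> ab b0 [fP optP]; split; first exact/feasible_numbers_of.
move=> Q' /numbers_of_surj[Q <- fQ]; rewrite !total_length_numbers_of.
have [O optO OQ] := optimal_exists fQ.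
apply: le_trans (optP O optO) _.
apply: le_trans (ler_wpM2r (ler0n _ _) ab) _.
by rewrite ler_wpM2l // ler_nat.
Qed.

Lemma solution_of_approx_nat (R : realType) (alpha : R) I Q :
  approx_nat alpha (matrix_of I) (pairs_of I) Q ->
  exists2 P, numbers_of P = Q & approx_solution alpha I P.
Proof.
move=> [/numbers_of_surj[P <- fP] optQ]; exists P => //; split=> // O [fO _].
have /optQ := proj1 (feasible_numbers_of O) fO.
by rewrite !total_length_numbers_of.
Qed.

(** Capping [delta] at 1 only weakens the guarantee and keeps the factor at least 1, hence
    nonnegative. *)
Lemma oracle_of_algorithm (R : realType) (delta : R) (A : cmd) : 0 < delta ->
  is_approx_algorithm graphic_multi_depot_vrp (2 - delta) A ->
  exists C, ptime_on (fun x => exists2 I, graphic_multi_depot_vrp I & x = data_of I) C /\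
    forall I, graphic_multi_depot_vrp I ->
      approx_nat (2 - Num.min delta 1) (matrix_of I) (pairs_of I) (C (data_of I)).
Proof.
move=> d0 [a [d algA]]; set V := graphic_multi_depot_vrp in algA *.
(* The answer is chosen for each input datum rather than for each instance, so that [C] is a
   function of what the program reads; outside the domain any value will do. *)
have ex (x : seq (seq bool) * seq (nat * nat)) : exists C,
    (exists2 I, V I & x = data_of I) ->
    (exists2 T, (T <= a * tree_size (enc x) ^ d + a)%N & computes_in A (enc x) T (enc C)) /\
    approx_nat (2 - Num.min delta 1) x.1 x.2 C.
  case: (pselect (exists2 I, V I & x = data_of I)) => [[I VI ->]|none]; last by exists [::].
  have [T [P [comp Tle optP]]] := algA I VI.
  exists (numbers_of P) => _; split.
    by exists T; rewrite enc_data_of // enc_numbers_of.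
  apply: approx_nat_of_solution optP.
    by rewrite lerD2l lerN2 ge_min lexx.
  by rewrite subr_ge0 ge_min [1 <= 2]ler1n orbT.
have [C CP] := choice ex; exists C; split; last first.
  by move=> I VI; have [|_] := CP (data_of I); first by exists I.
have [b bP] := size_enc (T := (seq (seq bool) * seq (nat * nat))%type).
apply: (ptime_on_of_program (c := A) (B := fun n => (a * (n.+2 ^ b) ^ d + a)%N)).
  by poly_bound; exact: poly_bounded_exp.
move=> x Dx; have [[T Tle comp] _] := CP x Dx; exists T => //.
apply: leq_trans Tle _; rewrite leq_add2r leq_mul2l; apply/orP; right.
by case: (d) => // d'; rewrite leq_exp2r // bP.
Qed.

Theorem theorem3 (R : realType) :
  exists f : R -> R,
    (forall x : R, 0 < x -> 0 < f x) /\
    forall delta : R, 0 < delta ->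
      (exists A : cmd,
         is_approx_algorithm graphic_multi_depot_vrp (2 - delta) A) ->
      exists B : cmd,
        is_approx_algorithm graphic_multi_path_tsp (2 - f delta) B.
Proof.
(* 49 = 1 + 48 is the total weight of the average of the two solutions. *)
exists (fun x => Num.min x 1 / 49); split.
  by move=> x x0; rewrite divr_gt0 ?ltr0n // lt_min x0 ltr01.
move=> delta d0 [A /(oracle_of_algorithm d0)[C [pC approxC]]].
have min0 : 0 < Num.min delta 1 by rewrite lt_min d0 ltr01.
have min1 : Num.min delta 1 <= 1 by rewrite ge_min lexx orbT.
pose D (x : seq (seq bool) * seq (nat * nat)) := exists I, x = data_of I.
pose mk (x : seq (seq bool) * seq (nat * nat)) := (x.1, depots x.1 x.2).
have mkD x : D x -> exists2 I, graphic_multi_depot_vrp I & mk x = data_of I.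
  move=> [I ->]; have [I' [VI' EM Ep]] := depot_instance I.
  by exists I'; rewrite // /mk /data_of EM Ep.
have pmk : ptime mk by rewrite /mk; auto 20 using ptime_depots with ptime.
have psolve : ptime (fun p : (seq (seq bool) * seq (nat * nat)) * seq (seq nat) =>
    solve p.1.1 p.1.2 p.2).
  by apply: ptime_solve; ptime_auto.
have : ptime_on D (fun x => solve x.1 x.2 (C (mk x))).
  apply: (ptime_on_comp (g := fun p => solve p.1.1 p.1.2 p.2)
    (f := fun x => (x, C (mk x))) _ psolve) => //.
  apply: ptime_on_pair; first exact: ptime_ptime_on (ptime_id _).
  exact: (ptime_on_comp (f := mk) (g := C) mkD pC (ptime_ptime_on _ pmk)).
(* The factor [3 ^ e] comes from [N + 2 <= 3 * N] for the encoding size [N >= 1]. *)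
move=> [B [m [T [e Te] BP]]]; exists B, (3 ^ e)%N, e => I _.
have [|||t tT ex] := BP (data_of I) (init_store (enc (data_of I))).
- by exists I.
- by [].
- by move=> y /andP[y0 _]; rewrite /init_store /update; case: eqP y0 => // ->.
(* The depot instance has exactly the data that [mk] produces, so the guarantee for [C] applies to
   the call made by the program. *)
have [I' [VI' EM Ep]] := depot_instance I.
have := approxC I' VI'; rewrite /data_of EM Ep => approxI.
have [P PE approxP] := solution_of_approx_nat (solve_approx min0 min1 approxI).
exists t, P; split=> //.
  by exists (update (init_store (enc (data_of I))) 0 (enc (solve (matrix_of I) (pairs_of I)
     (C (mk (data_of I)))))); rewrite -?enc_data_of // -enc_numbers_of PE.
apply: leq_trans tT _; apply: leq_trans (Te _) _; rewrite -enc_data_of.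
set N := tree_size _; have N0 : (0 < N)%N by apply: tree_size_gt0.
have nN : (nrm (data_of I) <= N)%N by apply: nrm_le.
apply: (@leq_trans ((3 * N) ^ e)%N); last by rewrite expnMn leq_addr.
by case: (e) => // e'; rewrite leq_exp2r //; lia.
Qed.
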